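(* Let $\mathsf{k}$ be an algebraically closed field, let $A$ be a finite-dimensional $\mathsf{k}$-algebra, and let $G$ be a finite group acting trivially on $A$, with $\operatorname{char}\mathsf{k}\nmid|G|$. Then $$\mathsf{FPdim}(A\ast G)=\mathsf{FPdim}(A).$$
   Context: For a finite group $G$ acting on $A$ by $\mathsf{k}$-algebra automorphisms, $A\ast G$ is the skew group algebra: the free $A$-module on the basis $G$ with multiplication determined by $ga=g(a)g$ for $g\in G$, $a\in A$, and the multiplications of $A$ and $G$. $\mathsf{k}$ is an algebraically closed field. An algebra means a finite-dimensional $\mathsf{k}$-algebra, not assumed connected; modules are finitely generated right modules, and $\mathsf{mod}\,A$ is the category of such $A$-modules. A module $S$ is a brick if $\mathrm{End}_A(S)$ is a division ring (equivalently $\mathrm{End}_A(S)\simeq\mathsf{k}$). A semibrick is a (possibly empty) set $\mathcal S$ of pairwise non-isomorphic bricks with $\mathrm{Hom}_A(S,S')=0$ for all non-isomorphic $S,S'\in\mathcal S$. For a finite semibrick $\mathcal S$, the $\mathrm{Ext}$-quiver $Q_{\mathcal S}$ has vertex set $\mathcal S$ and exactly $\dim_{\mathsf k}\mathrm{Ext}^1_A(S,S')$ arrows from $S$ to $S'$ (loops included). For a quiver $Q$, $\rho(Q)$ is the spectral radius (largest modulus of an eigenvalue) of its adjacency matrix, with $\rho=0$ for the empty quiver. The Frobenius--Perron dimension of $A$ is $\mathsf{FPdim}(A)=\sup\{\rho(Q_{\mathcal S})\mid \mathcal S \text{ a finite semibrick in } \mathsf{mod}\,A\}\in[0,\infty]$.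 *)

(* Defs.v *)
From HB Require Import structures.
From mathcomp Require Import all_boot all_order all_algebra all_fingroup.
From mathcomp Require Import complex.
From mathcomp Require Import all_classical all_reals ereal.

Set Implicit Arguments.
Unset Strict Implicit.
Unset Printing Implicit Defensive.

Import Order.TTheory GRing.Theory Num.Theory.

Local Open Scope ring_scope.
Local Open Scope classical_set_scope.

(* Finite-dimensional algebras over a field.  This is [falgType k] without the
   requirement [1 != 0] that MathComp builds into its algebras, so that the
   zero algebra is allowed. *)
HB.mixin Record Vector_isFdAlgebra (k : fieldType) A of Vector k A := {
  fd_one : A;
  fd_mul : A -> A -> A;
  fd_mulA : associative fd_mul;
  fd_mul1l : left_id fd_one fd_mul;
  fd_mul1r : right_id fd_one fd_mul;
  fd_mulDl : left_distributive fd_mul +%R;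
  fd_mulDr : right_distributive fd_mul +%R;
  fd_scaleAl : forall (c : k) (a b : A), c *: fd_mul a b = fd_mul (c *: a) b;
  fd_scaleAr : forall (c : k) (a b : A), c *: fd_mul a b = fd_mul a (c *: b)
}.

#[short(type="fdAlgType")]
HB.structure Definition FdAlgebra (k : fieldType) :=
  { A of Vector k A & Vector_isFdAlgebra k A }.

HB.instance Definition _ (k : fieldType) (A : fdAlgType k) :=
  GRing.Zmodule_isPzRing.Build (FdAlgebra.sort A) (@fd_mulA k A)
    (@fd_mul1l k A) (@fd_mul1r k A) (@fd_mulDl k A) (@fd_mulDr k A).

Section FdAlgebraTheory.

Variables (k : fieldType) (A : fdAlgType k).
Implicit Types (c : k) (a b : A).

Lemma fd_scalerAl c a b : c *: (a * b) = (c *: a) * b.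
Proof. exact: fd_scaleAl. Qed.

Lemma fd_scalerAr c a b : c *: (a * b) = a * (c *: b).
Proof. exact: fd_scaleAr. Qed.

End FdAlgebraTheory.

Section Linear.

Variables (k : fieldType) (V W : vectType k) (h : V -> W).
Hypothesis linh : linear h.

Let lh : V -> W := h.
HB.instance Definition _ := GRing.isLinear.Build k V W _ lh linh.

Fact linfunE v : linfun h v = h v.
Proof. exact: (lfunE lh). Qed.

Fact linear_fun0 : h 0 = 0.
Proof. exact: (linear0 lh). Qed.

Fact linear_fun_sum (n : nat) (c : 'I_n -> k) v :
  h (\sum_i c i *: v i) = \sum_i c i *: h (v i).
Proof.
rewrite -[h]/lh raddf_sum; apply: eq_bigr => i _.
exact: (linearZ_LR lh).
Qed.

End Linear.

Section Modules.

Variables (k : fieldType) (A : fdAlgType k).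

(* Over a finite-dimensional algebra, finitely generated is the same as
   finite-dimensional over k. *)
Record rmod := RMod {
  rmod_car :> vectType k;
  rmod_act : rmod_car -> A -> rmod_car;
  rmod_act_linearl : forall a : A, linear (rmod_act^~ a);
  rmod_act_linearr : forall m : rmod_car, linear (rmod_act m);
  rmod_act1 : forall m, rmod_act m 1 = m;
  rmod_actM : forall m (a b : A), rmod_act m (a * b) = rmod_act (rmod_act m a) b
}.

(* Hom_A(M, N); see [homAP]. *)
Definition homA (M N : rmod) : {vspace 'Hom(M, N)} :=
  (\bigcap_(a <- vbasis {:A}) \bigcap_(m <- vbasis {:M})
     lker (linfun
       (fun f : 'Hom(M, N) => f (rmod_act m a) - rmod_act (f m) a)))%VS.

Fact hom_defect_linear (M N : rmod) (m : M) (a : A) :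
  linear (fun f : 'Hom(M, N) => f (rmod_act m a) - rmod_act (f m) a).
Proof.
move=> c f g; rewrite !lfunE /= !lfunE /= rmod_act_linearl.
by rewrite opprD addrACA scalerBr.
Qed.

Lemma homAP (M N : rmod) (f : 'Hom(M, N)) :
  f \in homA M N <->
  forall (m : M) (a : A), f (rmod_act m a) = rmod_act (f m) a.
Proof.
have memE m a : (f \in lker (linfun
    (fun f : 'Hom(M, N) => f (rmod_act m a) - rmod_act (f m) a)))
    = (f (rmod_act m a) == rmod_act (f m) a).
  by rewrite memv_ker (linfunE (@hom_defect_linear M N m a)) subr_eq0.
have bigcapP (T : eqType) (s : seq T) (U : T -> {vspace 'Hom(M, N)}) :
    (f \in (\bigcap_(t <- s) U t)%VS) = all (fun t => f \in U t) s.
  by elim: s => [|t s IHs]; rewrite ?big_nil ?memvf // big_cons memv_cap IHs.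
split=> [|homf]; last first.
  rewrite bigcapP; apply/allP => a _; rewrite bigcapP.
  by apply/allP => m _; rewrite memE homf.
rewrite bigcapP => /allP homf m a.
have lin_m : linear (fun x : M => f (rmod_act x a)).
  by move=> c u v; rewrite rmod_act_linearl linearP.
have lin_m' : linear (fun x : M => rmod_act (f x) a).
  by move=> c u v; rewrite linearP rmod_act_linearl.
rewrite (coord_vbasis (memvf m)).
rewrite (linear_fun_sum lin_m) (linear_fun_sum lin_m').
apply: eq_bigr => j _; congr (_ *: _).
set e := (vbasis {:M})`_j.
have lin_a : linear (fun x : A => f (rmod_act e x)).
  by move=> c u v; rewrite rmod_act_linearr linearP.
rewrite (coord_vbasis (memvf a)).
rewrite (linear_fun_sum lin_a) (linear_fun_sum (rmod_act_linearr (f e))).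
apply: eq_bigr => i _; congr (_ *: _); apply/eqP; rewrite -memE.
have /homf: (vbasis {:A})`_i \in vbasis {:A} by rewrite mem_nth ?size_tuple.
by rewrite bigcapP => /allP; apply; rewrite mem_nth ?size_tuple.
Qed.

Definition isoA (M N : rmod) : Prop :=
  exists f g, [/\ f \in homA M N, g \in homA N M,
    (g \o f)%VF = \1%VF & (f \o g)%VF = \1%VF].

(* End_A(S) is a division ring. *)
Definition brick (S : rmod) : Prop :=
  (\1%VF != 0 :> 'End(S)) /\
  (forall f : 'End(S), f \in homA S S -> f != 0 ->
     exists g : 'End(S), [/\ g \in homA S S,
       (g \o f)%VF = \1%VF & (f \o g)%VF = \1%VF]).

(* A finite semibrick, enumerated without repetition of isomorphism classes. *)
Definition semibrick (n : nat) (S : 'I_n -> rmod) : Prop :=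
  [/\ forall i, brick (S i),
      forall i j, i != j -> ~ isoA (S i) (S j)
    & forall i j, ~ isoA (S i) (S j) -> homA (S i) (S j) = 0%VS].

Section FreeModule.

Variable n : nat.
Implicit Types (x y : {ffun 'I_n -> A}) (a b : A).

Definition free_act x a : {ffun 'I_n -> A} := [ffun i => x i * a].

Fact free_act_linearl a : linear (free_act^~ a).
Proof.
by move=> c x y; apply/ffunP => i; rewrite !ffunE mulrDl fd_scalerAl.
Qed.

Fact free_act_linearr x : linear (free_act x).
Proof.
by move=> c a b; apply/ffunP => i; rewrite !ffunE mulrDr fd_scalerAr.
Qed.

Fact free_act1 x : free_act x 1 = x.
Proof. by apply/ffunP => i; rewrite ffunE mulr1. Qed.

Fact free_actM x a b : free_act x (a * b) = free_act (free_act x a) b.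
Proof. by apply/ffunP => i; rewrite !ffunE mulrA. Qed.

Definition free_rmod : rmod :=
  RMod free_act_linearl free_act_linearr free_act1 free_actM.

End FreeModule.

Section Submodule.

Variables (M : rmod) (U : {vspace M}).
Hypothesis stableU : forall u a, u \in U -> rmod_act u a \in U.
Implicit Types (u v : subvs_of U) (a b : A).

Definition sub_act u a : subvs_of U := vsproj U (rmod_act (vsval u) a).

Fact sub_actE u a : vsval (sub_act u a) = rmod_act (vsval u) a.
Proof. by rewrite vsprojK // stableU // subvsP. Qed.

Let vsvalI : injective (@vsval _ _ U).
Proof. exact: val_inj. Qed.

Fact sub_act_linearl a : linear (sub_act^~ a).
Proof.
move=> c u v; apply: vsvalI.
by rewrite [RHS](linearP vsval) /= !sub_actE linearP rmod_act_linearl.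
Qed.

Fact sub_act_linearr u : linear (sub_act u).
Proof.
move=> c a b; apply: vsvalI.
by rewrite [RHS](linearP vsval) /= !sub_actE rmod_act_linearr.
Qed.

Fact sub_act1 u : sub_act u 1 = u.
Proof. by apply: vsvalI; rewrite sub_actE rmod_act1. Qed.

Fact sub_actM u a b : sub_act u (a * b) = sub_act (sub_act u a) b.
Proof. by apply: vsvalI; rewrite !sub_actE rmod_actM. Qed.

Definition sub_rmod : rmod :=
  RMod sub_act_linearl sub_act_linearr sub_act1 sub_actM.

End Submodule.

(* Ext^1_A(M, N), computed from the short exact sequence
     0 -> syzygy M -> A^n -> M -> 0,   n = dim_k M,
   where A^n -> M sends the i-th generator to the i-th vector of a k-basis
   of M: since A^n is free, the long exact sequence gives
     Ext^1_A(M, N) = coker (Hom_A(A^n, N) -> Hom_A(syzygy M, N)). *)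
Section Ext.

Variable M : rmod.

Definition free_cover : rmod := free_rmod (\dim {:M}).

Definition free_cover_map (x : free_cover) : M :=
  \sum_(i < \dim {:M}) rmod_act (vbasis {:M})`_i (x i).

Fact free_cover_map_linear : linear free_cover_map.
Proof.
move=> c x y; rewrite /free_cover_map scaler_sumr -big_split /=.
by apply: eq_bigr => i _; rewrite !ffunE rmod_act_linearr.
Qed.

HB.instance Definition _ :=
  GRing.isLinear.Build k free_cover M _ free_cover_map free_cover_map_linear.

Lemma free_cover_map_hom : linfun free_cover_map \in homA free_cover M.
Proof.
apply/homAP => x a; rewrite !lfunE /= /free_cover_map.
rewrite (big_morph (fun m : M => rmod_act m a) (id1 := 0) (op1 := +%R)).
- by apply: eq_bigr => i _; rewrite ffunE rmod_actM.
- by move=> u v; have := rmod_act_linearl a 1 u v; rewrite !scale1r.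
- exact: (linear_fun0 (rmod_act_linearl a)).
Qed.

Lemma free_cover_map_surj (m : M) : exists x : free_cover, free_cover_map x = m.
Proof.
exists ([ffun i => coord (vbasis {:M}) i m *: (1 : A)]
  : {ffun 'I_(\dim {:M}) -> A}).
rewrite [RHS](coord_vbasis (memvf m)) /free_cover_map; apply: eq_bigr => i _.
have := rmod_act_linearr (vbasis {:M})`_i (coord (vbasis {:M}) i m) 1 0.
rewrite ffunE addr0 => ->.
by rewrite (linear_fun0 (rmod_act_linearr _)) addr0 rmod_act1.
Qed.

Fact free_cover_ker_stable (x : free_cover) (a : A) :
  x \in lker (linfun free_cover_map) ->
  rmod_act x a \in lker (linfun free_cover_map).
Proof.
have /homAP homc := free_cover_map_hom.
rewrite !memv_ker homc => /eqP ->.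
by rewrite (linear_fun0 (rmod_act_linearl a)).
Qed.

Definition syzygy : rmod := sub_rmod free_cover_ker_stable.

Definition syzygy_incl : 'Hom(syzygy, free_cover) :=
  linfun (vsval : subvs_of (lker (linfun free_cover_map)) -> free_cover).

Variable N : rmod.

Definition hom_restr (f : 'Hom(free_cover, N)) : 'Hom(syzygy, N) :=
  (f \o syzygy_incl)%VF.

Fact hom_restr_linear : linear hom_restr.
Proof. by move=> c f g; rewrite /hom_restr comp_lfunDl comp_lfunZl. Qed.

HB.instance Definition _ := GRing.isLinear.Build k
  'Hom(free_cover, N) 'Hom(syzygy, N) _ hom_restr hom_restr_linear.

Definition hom_restr_img : {vspace 'Hom(syzygy, N)} :=
  (linfun hom_restr @: homA free_cover N)%VS.

Lemma hom_restr_sub : (hom_restr_img <= homA syzygy N)%VS.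
Proof.
apply/subvP => _ /memv_imgP[f /homAP homf ->]; apply/homAP => u a.
rewrite lfunE /= !comp_lfunE !lfunE /= -homf; congr (f _).
exact: (sub_actE free_cover_ker_stable).
Qed.

Definition ext1_dim : nat := (\dim (homA syzygy N) - \dim hom_restr_img)%N.

End Ext.

(* A quiver with vertex set 'I_n is given by its adjacency matrix. *)
Definition ext_quiver (n : nat) (S : 'I_n -> rmod) : 'M[nat]_n :=
  \matrix_(i, j) ext1_dim (S i) (S j).

End Modules.

(* [sup set0 = 0], so this is 0 for the empty quiver. *)
Definition spectral_radius (R : realType) (n : nat) (Q : 'M[nat]_n) : R :=
  sup [set ComplexField.Normc.normc z | z in
        [set z : R[i] | eigenvalue (map_mx (fun m : nat => m%:R) Q) z]].

Lemma spectral_radius_empty (R : realType) (Q : 'M[nat]_0) :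
  spectral_radius R Q = 0.
Proof.
rewrite /spectral_radius [X in sup X](_ : _ = set0) ?sup0 //.
rewrite -subset0 => y [z /eigenvalueP[v _ /eqP vn0] _].
by case: vn0; apply/rowP; case.
Qed.

Definition FPdim (R : realType) (k : fieldType) (A : fdAlgType k) : \bar R :=
  ereal_sup [set x | exists (n : nat) (S : 'I_n -> rmod A),
    semibrick S /\ x = (spectral_radius R (ext_quiver S))%:E].

(* An action of a finite group on A by k-algebra automorphisms; it is a left
   action, and bijectivity of each [alg_act g] follows from the group laws. *)
Record alg_action (gT : finGroupType) (k : fieldType) (A : fdAlgType k) :=
  AlgAction {
  alg_act :> gT -> A -> A;
  alg_act_linear : forall g, linear (alg_act g);
  alg_act1r : forall g, alg_act g 1 = 1;
  alg_actMr : forall g a b, alg_act g (a * b) = alg_act g a * alg_act g b;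
  alg_act_id : forall a, alg_act 1%g a = a;
  alg_act_comp : forall g h a, alg_act (g * h)%g a = alg_act g (alg_act h a)
}.

Section SkewGroupAlgebra.

Variables (gT : finGroupType) (k : fieldType) (A : fdAlgType k).
Variable act : alg_action gT A.

(* x : skew_group_alg act stands for \sum_g (x g) g in A * G.  The alias is
   needed since {ffun gT -> A} already carries the pointwise product. *)
Definition skew_group_alg of alg_action gT A : Type := {ffun gT -> A}.
Local Notation skewA := (skew_group_alg act).

HB.instance Definition _ := Vector.copy skewA {ffun gT -> A}.

Implicit Types x y z : skewA.

(* The element a g of A * G. *)
Definition skew_elt (a : A) (g : gT) : skewA :=
  [ffun u => if u == g then a else 0].

Definition skew_one : skewA := skew_elt 1 1%g.

Definition skew_mul x y : skewA :=
  [ffun u => \sum_g x g * act g (y (g^-1 * u)%g)].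

Let alg_act0r g : act g 0 = 0.
Proof. exact: (linear_fun0 (alg_act_linear act g)). Qed.

Let alg_actDr g a b : act g (a + b) = act g a + act g b.
Proof. by have := alg_act_linear act g 1 a b; rewrite !scale1r. Qed.

Let alg_actZr g c a : act g (c *: a) = c *: act g a.
Proof. by have := alg_act_linear act g c a 0; rewrite alg_act0r !addr0. Qed.

Let alg_act_sum g (I : finType) (F : I -> A) :
  act g (\sum_i F i) = \sum_i act g (F i).
Proof. exact: (big_morph _ (alg_actDr g) (alg_act0r g)). Qed.

Lemma skew_mul_elt a g b h :
  skew_mul (skew_elt a g) (skew_elt b h) = skew_elt (a * act g b) (g * h)%g.
Proof.
apply/ffunP => u; rewrite !ffunE (bigD1 g) //= big1 => [|v vg].
  rewrite !ffunE eqxx addr0 -(inj_eq (mulgI g)) mulKVg.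
  by case: ifP; rewrite // alg_act0r mulr0.
by rewrite !ffunE (negPf vg) mul0r.
Qed.

Fact skew_mulA : associative skew_mul.
Proof.
move=> x y z; apply/ffunP => u; rewrite !ffunE.
under eq_bigr => g _ do rewrite ffunE alg_act_sum mulr_sumr.
under [RHS]eq_bigr => g _ do rewrite ffunE mulr_suml.
rewrite [RHS]exchange_big /=; apply: eq_bigr => g _.
rewrite [RHS](reindex_inj (mulgI g)) /=; apply: eq_bigr => h _.
by rewrite alg_actMr -alg_act_comp mulrA mulKg invMg mulgA.
Qed.

Fact skew_mul1l : left_id skew_one skew_mul.
Proof.
move=> x; apply/ffunP => u; rewrite !ffunE (bigD1 1%g) //= big1 => [|v vg].
  by rewrite !ffunE eqxx mul1r invg1 mul1g alg_act_id addr0.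
by rewrite !ffunE (negPf vg) mul0r.
Qed.

Fact skew_mul1r : right_id skew_one skew_mul.
Proof.
move=> x; apply/ffunP => u; rewrite !ffunE (bigD1 u) //= big1 => [|v vg].
  by rewrite !ffunE mulVg eqxx alg_act1r mulr1 addr0.
rewrite !ffunE -(inj_eq (mulgI v)) mulKVg mulg1 eq_sym (negPf vg).
by rewrite alg_act0r mulr0.
Qed.

Fact skew_mulDl : left_distributive skew_mul +%R.
Proof.
move=> x y z; apply/ffunP => u; rewrite !ffunE -big_split /=.
by apply: eq_bigr => g _; rewrite ffunE mulrDl.
Qed.

Fact skew_mulDr : right_distributive skew_mul +%R.
Proof.
move=> x y z; apply/ffunP => u; rewrite !ffunE -big_split /=.
by apply: eq_bigr => g _; rewrite ffunE alg_actDr mulrDr.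
Qed.

Fact skew_scaleAl (c : k) x y : c *: skew_mul x y = skew_mul (c *: x) y.
Proof.
apply/ffunP => u; rewrite !ffunE scaler_sumr.
by apply: eq_bigr => g _; rewrite ffunE fd_scalerAl.
Qed.

Fact skew_scaleAr (c : k) x y : c *: skew_mul x y = skew_mul x (c *: y).
Proof.
apply/ffunP => u; rewrite !ffunE scaler_sumr.
by apply: eq_bigr => g _; rewrite ffunE alg_actZr fd_scalerAr.
Qed.

HB.instance Definition _ := Vector_isFdAlgebra.Build k skewA skew_mulA
  skew_mul1l skew_mul1r skew_mulDl skew_mulDr skew_scaleAl skew_scaleAr.

HB.instance Definition _ := GRing.Zmodule_isPzRing.Build skewA
  skew_mulA skew_mul1l skew_mul1r skew_mulDl skew_mulDr.

End SkewGroupAlgebra.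

(* Main.v *)
(* The group G acts on an A*G-module by A-linear maps, so all annihilators in kG
   of a brick S can be compared: two bricks with different annihilators admit
   neither G-linear maps nor extensions between them.  For bricks with the same
   annihilator, a primitive idempotent e of kG not killing them yields A-modules
   T = S e with Hom_G(S, S') = Hom_k(T, T'), compatibly with A.  Computing Ext^1
   by cocycles A*G -> Hom_k(S, S'), which can be made to vanish on G by
   averaging, this identifies Hom and Ext^1 over A*G with those over A.  Hence
   the Ext-quiver of a semibrick over A*G is a disjoint union of Ext-quivers of
   semibricks over A, and each eigenvalue of the union is one of a component.
   Conversely, inflation along A*G -> A preserves Ext-quivers. *)
Require Import Defs.
From mathcomp Require Import all_boot all_order all_algebra all_fingroup.
From mathcomp Require Import complex zify ring.
From mathcomp Require Import all_classical all_reals ereal.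

Set Implicit Arguments.
Unset Strict Implicit.
Unset Printing Implicit Defensive.

Import Order.TTheory GRing.Theory Num.Theory.
Local Open Scope ring_scope.

(** * Linear maps, subspaces cut out by predicates, dimensions of quotients *)

Section LinearAlgebra.

Variable k : fieldType.

Section LinearFun.

Variables (V W : vectType k) (h : V -> W).
Hypothesis linh : linear h.

Lemma lin_D u v : h (u + v) = h u + h v.
Proof. by rewrite -!(linfunE linh) linearD. Qed.

Lemma lin_B u v : h (u - v) = h u - h v.
Proof. by rewrite -!(linfunE linh) linearB. Qed.

Lemma lin_N v : h (- v) = - h v.
Proof. by rewrite -!(linfunE linh) linearN. Qed.

Lemma lin_Z c v : h (c *: v) = c *: h v.
Proof. by rewrite -!(linfunE linh) linearZ. Qed.

Lemma lin_sum (I : Type) (r : seq I) (P : pred I) (F : I -> V) :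
  h (\sum_(i <- r | P i) F i) = \sum_(i <- r | P i) h (F i).
Proof.
by rewrite -(linfunE linh) linear_sum; apply: eq_bigr => i _ /=;
  rewrite linfunE.
Qed.

End LinearFun.

Lemma linear_sum_fun (V W : vectType k) (I : Type) (r : seq I)
    (F : I -> V -> W) :
  (forall i, linear (F i)) -> linear (fun v => \sum_(i <- r) F i v).
Proof.
move=> linF c u v; rewrite scaler_sumr -big_split /=.
by apply: eq_bigr => i _; rewrite linF.
Qed.

Lemma bilinear_hom (U V W : vectType k) (F : U -> V -> W) :
  (forall v, linear (F^~ v)) -> (forall u, linear (F u)) ->
  exists c : 'Hom(U, 'Hom(V, W)), forall u v, c u v = F u v.
Proof.
move=> linl linr.
have lin : linear (fun u => linfun (F u)).
  move=> c u v; apply/lfunP => w.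
  by rewrite (linfunE (linr _)) !lfunE /= !lfunE /=
    !(linfunE (linr _)) (linl w).
by exists (linfun (fun u => linfun (F u))) => u v; rewrite (linfunE lin)
  linfunE.
Qed.

(** Among the subspaces contained in [P], one of maximal dimension must be all of [P]: a vector of
    [P] outside it would span a larger one with it. *)
Lemma subspace_vspace (V : vectType k) (P : V -> Prop) :
  P 0 -> (forall c u v, P u -> P v -> P (c *: u + v)) ->
  exists U : {vspace V}, forall v, v \in U <-> P v.
Proof.
move=> P0 Plin.
pose Q d := `[< exists2 U : {vspace V}, \dim U = d & forall v, v \in U -> P v >].
have Q0 : exists d, Q d.
  exists 0; apply/asboolP; exists 0%VS; rewrite ?dimv0 // => v.
  by rewrite memv0 => /eqP->.
have Qub d : Q d -> (d <= \dim {:V})%N.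
  by move=> /asboolP[U <- _]; apply/dimvS/subvf.
have [d /asboolP[U dimU UP] dmax] := ex_maxnP Q0 Qub.
exists U => v; split=> [/UP//|Pv].
have sUUv : (U <= U + <[v]>)%VS := addvSl _ _.
have /eqP-> : U == (U + <[v]>)%VS.
  rewrite -(dimv_leqif_eq sUUv) eqn_leq dimvS //= dimU; apply: dmax.
  apply/asboolP; exists (U + <[v]>)%VS => // w /memv_addP[u uU [_ /vlineP[c ->]]] ->.
  by rewrite addrC; apply: Plin => //; apply: UP.
by apply: (subvP (addvSr U <[v]>)); apply: memv_line.
Qed.

(** The hypotheses make [f] induce an isomorphism from Z/B to Z'/B'. In dimensions: Z' = f(Z) + B',
    the intersection of f(Z) and B' is f(B), and the kernel of [f] on Z lies in B. *)
Lemma dim_quotient_eq (V W : vectType k) (f : 'Hom(V, W))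
    (Z B : {vspace V}) (Z' B' : {vspace W}) :
  (B <= Z)%VS -> (B' <= Z')%VS ->
  (forall z, z \in Z -> f z \in Z') -> (forall b, b \in B -> f b \in B') ->
  (forall z, z \in Z -> f z \in B' -> z \in B) ->
  (forall z', z' \in Z' -> exists2 z, z \in Z & z' - f z \in B') ->
  (\dim Z - \dim B = \dim Z' - \dim B')%N.
Proof.
move=> sBZ sB'Z' fZ fB finj fsurj.
have Z'E : Z' = (f @: Z + B')%VS.
  apply/vspaceP => w; apply/idP/memv_addP => [/fsurj[z zZ wz]|].
    by exists (f z); [apply: memv_img|exists (w - f z) => //; rewrite addrC subrK].
  move=> [_ /memv_imgP[z zZ ->] [b bB ->]]; apply: rpredD; first exact: fZ.
  exact: (subvP sB'Z').
have capE : (f @: Z :&: B' = f @: B)%VS.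
  apply/vspaceP => w; rewrite memv_cap; apply/andP/memv_imgP.
    by move=> [/memv_imgP[z zZ ->] zB']; exists z => //; apply: finj.
  by move=> [b bB ->]; split; [apply: memv_img; apply: (subvP sBZ)|apply: fB].
have kerE : (Z :&: lker f = B :&: lker f)%VS.
  apply/vspaceP => v; rewrite !memv_cap memv_ker.
  have [fv0|] := eqVneq (f v) 0; rewrite ?andbT ?andbF //.
  apply/idP/idP => [vZ|]; last exact: (subvP sBZ).
  by apply: finj; rewrite // fv0 mem0v.
have := dimv_sum_cap (f @: Z) B'; rewrite capE -Z'E.
have := limg_ker_dim f Z; have := limg_ker_dim f B; rewrite kerE.
have := dimvS sBZ; have := dimvS sB'Z'.
move: (\dim (B :&: lker f)) (\dim (f @: B)) (\dim (f @: Z)) => x y z.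
by lia.
Qed.

End LinearAlgebra.

Section ModuleTheory.

Variables (k : fieldType) (A : fdAlgType k) (M : rmod A).

Definition act_l0 (a : A) := linear_fun0 (rmod_act_linearl (r := M) a).
Definition act_lD (a : A) := lin_D (rmod_act_linearl (r := M) a).
Definition act_lB (a : A) := lin_B (rmod_act_linearl (r := M) a).
Definition act_lN (a : A) := lin_N (rmod_act_linearl (r := M) a).
Definition act_lZ (a : A) := lin_Z (rmod_act_linearl (r := M) a).
Definition act_lsum (a : A) := lin_sum (rmod_act_linearl (r := M) a).
Definition act_r0 (m : M) := linear_fun0 (rmod_act_linearr m).
Definition act_rB (m : M) := lin_B (rmod_act_linearr m).
Definition act_rZ (m : M) := lin_Z (rmod_act_linearr m).
Definition act_rsum (m : M) := lin_sum (rmod_act_linearr m).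

End ModuleTheory.

(** * Ext^1 as cocycles modulo coboundaries *)

Section ExtCocycles.

Variables (k : fieldType) (A : fdAlgType k) (M N : rmod A).

(** The condition for (n, m) a = (n a + c(a)(m), m a) to be a module structure on the direct sum of
    N and M. *)
Definition cocycle (c : 'Hom(A, 'Hom(M, N))) : Prop :=
  forall a b m, c (a * b) m = c b (rmod_act m a) + rmod_act (c a m) b.

Definition coboundary (c : 'Hom(A, 'Hom(M, N))) : Prop :=
  exists h : 'Hom(M, N), forall a m,
    c a m = h (rmod_act m a) - rmod_act (h m) a.

Lemma coboundary_hom (h : 'Hom(M, N)) : exists c : 'Hom(A, 'Hom(M, N)),
  forall a m, c a m = h (rmod_act m a) - rmod_act (h m) a.
Proof.
apply: (bilinear_hom (F := fun a m => h (rmod_act m a) - rmod_act (h m) a)).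
  move=> m c a b; rewrite !rmod_act_linearr linearP scalerBr.
  by rewrite opprD addrACA.
move=> a c m n; rewrite !(linearP h, rmod_act_linearl) scalerBr.
by rewrite opprD addrACA.
Qed.

Lemma coboundary_cocycle c : coboundary c -> cocycle c.
Proof.
move=> [h hE] a b m; rewrite !hE !rmod_actM act_lB.
by rewrite addrA subrK.
Qed.

Lemma cocycle_space : exists Z : {vspace 'Hom(A, 'Hom(M, N))},
  forall c, c \in Z <-> cocycle c.
Proof.
apply: subspace_vspace => [a b m|x c d cZ dZ a b m].
  by rewrite !zero_lfunE act_l0 addr0.
rewrite !(add_lfunE, scale_lfunE) cZ dZ act_lD act_lZ scalerDr.
by rewrite addrACA.
Qed.

Lemma coboundary_space : exists B : {vspace 'Hom(A, 'Hom(M, N))},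
  forall c, c \in B <-> coboundary c.
Proof.
apply: subspace_vspace => [|x c d [g gE] [h hE]].
  by exists 0 => a m; rewrite !zero_lfunE act_l0 subrr.
exists (x *: g + h) => a m.
rewrite !(add_lfunE, scale_lfunE) gE hE act_lD act_lZ scalerBr.
by rewrite opprD addrACA.
Qed.

Lemma cocycle1 c m : cocycle c -> c 1 m = 0.
Proof.
move=> /(_ 1 1 m); rewrite mulr1 !rmod_act1 => /eqP.
by rewrite -subr_eq0 opprD addrA subrr sub0r oppr_eq0 => /eqP.
Qed.

Local Notation n := (\dim {:M}).
Let e (i : 'I_n) : M := (vbasis {:M})`_i.
Let cf (i : 'I_n) (m : M) : k := coord (vbasis {:M}) i m.
Let cf_lin i y u v : cf i (y *: u + v) = y * cf i u + cf i v.
Proof. by rewrite /cf linearP. Qed.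

Let cf_basis i j : cf i (e j) = (i == j)%:R.
Proof. by rewrite /cf /e coord_free ?(basis_free (vbasisP _)) // eq_sym. Qed.

Let gen (x : syzygy M) (i : 'I_n) : A := (vsval x : {ffun 'I_n -> A}) i.

Let gen_linear i : linear (gen^~ i).
Proof.
move=> c x y; rewrite /gen.
transitivity ((c *: (vsval x : {ffun 'I_n -> A}) + vsval y) i).
  exact: (congr1 (fun z : {ffun 'I_n -> A} => z i) (linearP vsval c x y)).
by rewrite !ffunE.
Qed.

Let gen_act x b i : gen (rmod_act x b) i = gen x i * b.
Proof.
rewrite /gen.
transitivity (free_act (vsval x : {ffun 'I_n -> A}) b i); last by rewrite ffunE.
exact: (congr1 (fun z : {ffun 'I_n -> A} => z i)
  (sub_actE (@free_cover_ker_stable k A M) x b)).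
Qed.

Let gen_inj x y : gen x =1 gen y -> x = y.
Proof. by move=> xy; apply/val_inj/ffunP. Qed.

Let gen_rel x : \sum_i rmod_act (e i) (gen x i) = 0.
Proof. by have := subvsP x; rewrite memv_ker lfunE => /eqP. Qed.

Let syzygy_gen (F : 'I_n -> A) : \sum_i rmod_act (e i) (F i) = 0 ->
  exists x, gen x =1 F.
Proof.
move=> F0; pose f : free_cover M := [ffun i => F i].
have fK : f \in lker (linfun (@free_cover_map k A M)).
  rewrite memv_ker lfunE /= /free_cover_map -[X in _ == X]F0; apply/eqP.
  by apply: eq_bigr => i _; rewrite ffunE.
exists (vsproj _ f) => i; rewrite /gen.
transitivity (f i); last by rewrite ffunE.
exact: (congr1 (fun z : {ffun 'I_n -> A} => z i) (vsprojK fK)).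
Qed.

Let hom_basis (L : rmod A) (h : 'Hom(M, L)) m : \sum_i cf i m *: h (e i) = h m.
Proof.
rewrite [in RHS](coord_vbasis (memvf m)) linear_sum; apply: eq_bigr => i _.
by rewrite linearZ.
Qed.

Let basisE m : \sum_i cf i m *: e i = m.
Proof. by rewrite [RHS](coord_vbasis (memvf m)). Qed.

(** Expand m a and m in the basis of M: the lift of m a minus the lift of m times a is a relation
    between the generators. These relations carry the values of the cocycle attached to a hom on the
    syzygy. *)
Let syz_rel m a : exists x, forall i,
  gen x i = cf i (rmod_act m a) *: (1 : A) - cf i m *: a.
Proof.
apply: (syzygy_gen (F := fun i => cf i (rmod_act m a) *: (1 : A) - cf i m *: a)).
under eq_bigr do rewrite act_rB !act_rZ rmod_act1.
rewrite sumrB basisE -[in X in X - _](basisE m) act_lsum.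
by under eq_bigr do rewrite act_lZ; rewrite subrr.
Qed.

Let cocycle_sum (c : 'Hom(A, 'Hom(M, N))) : exists f : 'Hom(syzygy M, N),
  forall x, f x = \sum_i c (gen x i) (e i).
Proof.
have lin : linear (fun x => \sum_i c (gen x i) (e i)).
  by apply: linear_sum_fun => i y u v; rewrite gen_linear linearP /=
    add_lfunE scale_lfunE.
by exists (linfun (fun x => \sum_i c (gen x i) (e i))) => x; rewrite linfunE.
Qed.

Let cocycle_rel c x m a : cocycle c ->
    (forall i, gen x i = cf i (rmod_act m a) *: (1 : A) - cf i m *: a) ->
  \sum_i c (gen x i) (e i) = - c a m.
Proof.
move=> cZ xE; rewrite -(hom_basis (c a) m) -sumrN; apply: eq_bigr => i _.
rewrite xE linearB !linearZ /= add_lfunE !scale_lfunE opp_lfunE cocycle1 //.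
by rewrite scaler0 add0r scalerN.
Qed.

(** A hom on the free cover amounts to a choice of images [h i] of the generators. *)
Let restr_imgP (f : 'Hom(syzygy M, N)) : f \in hom_restr_img M N <->
  exists h : 'I_n -> N, forall x, f x = \sum_i rmod_act (h i) (gen x i).
Proof.
split=> [/memv_imgP[g /homAP homg ->]|[h fE]].
  pose d i : free_cover M := [ffun j => if j == i then 1 else 0].
  exists (fun i => g (d i)) => x; rewrite lfunE /= /hom_restr comp_lfunE lfunE /=.
  rewrite -[LHS]/(g (vsval x)); under eq_bigr do rewrite -homg.
  rewrite -linear_sum; congr (g _); apply/ffunP => j.
  rewrite sum_ffunE (bigD1 j) //= big1 => [|i ij]; rewrite !ffunE.
    by rewrite eqxx mul1r addr0.
  by rewrite eq_sym (negPf ij) mul0r.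
have lin : linear (fun x : free_cover M => \sum_i rmod_act (h i) (x i)).
  by apply: linear_sum_fun => i c u v; rewrite !ffunE rmod_act_linearr.
apply/memv_imgP; exists (linfun (fun x : free_cover M =>
  \sum_i rmod_act (h i) (x i))).
  apply/homAP => x a; rewrite !(linfunE lin) act_lsum.
  by apply: eq_bigr => i _; rewrite ffunE rmod_actM.
by apply/lfunP => x; rewrite fE lfunE /= /hom_restr comp_lfunE (linfunE lin) lfunE.
Qed.

(* The i-th generator of the free cover lifts the i-th basis vector, so a hom
   on the syzygy is the same thing as a cocycle: [c] corresponds to
   [x |-> \sum_i c (x i) (e i)]. *)
Lemma ext1_dimE (Z B : {vspace 'Hom(A, 'Hom(M, N))}) :
  (forall c, c \in Z <-> cocycle c) -> (forall c, c \in B <-> coboundary c) ->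
  ext1_dim M N = (\dim Z - \dim B)%N.
Proof.
move=> ZP BP; have [Psi0 Psi0E] := choice cocycle_sum.
have Psi_lin : linear Psi0.
  move=> y c d; apply/lfunP => x; rewrite add_lfunE scale_lfunE !Psi0E.
  rewrite scaler_sumr -big_split; apply: eq_bigr => i _.
  by rewrite !(add_lfunE, scale_lfunE).
have PsiE c x : linfun Psi0 c x = \sum_i c (gen x i) (e i).
  by rewrite (linfunE Psi_lin) Psi0E.
have sBZ : (B <= Z)%VS.
  by apply/subvP => c /BP/coboundary_cocycle/ZP.
symmetry; apply: (@dim_quotient_eq _ _ _ (linfun Psi0)) => //.
- exact: hom_restr_sub.
- move=> c /ZP cZ; apply/homAP => x b; rewrite !PsiE act_lsum.
  under eq_bigr do rewrite gen_act cZ.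
  by rewrite big_split /= -linear_sum gen_rel linear0 add0r.
- move=> c /BP[h cE]; apply/restr_imgP; exists (fun i => - h (e i)) => x.
  rewrite PsiE; under eq_bigr do rewrite cE.
  rewrite sumrB -linear_sum gen_rel linear0 sub0r -sumrN.
  apply: eq_bigr => i _.
  by rewrite act_lN.
- move=> c /ZP cZ /restr_imgP[h fE]; apply/BP.
  (* The linear extension of [e i |-> - h i]; evaluating [fE] at the relation of [m] and [a] shows
     that [c] is its coboundary. *)
  pose h' m := - \sum_i cf i m *: h i.
  have lin_h' : linear h'.
    move=> y u v; rewrite /h' scalerN -opprD scaler_sumr -big_split /=.
    by congr (- _); apply: eq_bigr => i _; rewrite /cf linearP scalerDl scalerA.
  exists (linfun h') => a m; rewrite !(linfunE lin_h').
  have [x xE] := syz_rel m a; have := fE x.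
  rewrite PsiE (cocycle_rel cZ xE) => /(canRL (@opprK _)) ->.
  under eq_bigr do rewrite xE act_rB !act_rZ rmod_act1.
  rewrite sumrB opprB /h' act_lN opprK act_lsum [RHS]addrC.
  by congr (_ - _); apply: eq_bigr => i _; rewrite act_lZ.
- move=> phi /homAP homphi.
  have [rel1 rel1E] := choice (fun p => syz_rel p.1 p.2).
  pose rel0 m a := rel1 (m, a).
  have rel0E m a i : gen (rel0 m a) i =
      cf i (rmod_act m a) *: (1 : A) - cf i m *: a by rewrite rel1E.
  (* By [cocycle_rel], no other [c] can map to [phi]. *)
  have [c cE] : exists c : 'Hom(A, 'Hom(M, N)), forall a m,
      c a m = - phi (rel0 m a).
    apply: (bilinear_hom (F := fun a m => - phi (rel0 m a))) => [m|a] y u v.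
      rewrite scalerN -opprD -linearP; congr (- phi _); apply: gen_inj => i.
      rewrite gen_linear !rel0E rmod_act_linearr /cf linearP /=.
      rewrite scalerDl scalerDr -scalerA scalerBr opprD addrACA.
      by rewrite !scalerA [y * cf i m]mulrC.
    rewrite scalerN -opprD -linearP; congr (- phi _); apply: gen_inj => i.
    rewrite gen_linear !rel0E rmod_act_linearl !cf_lin.
    by rewrite !scalerDl -!scalerA scalerBr opprD addrACA.
  exists c.
    apply/ZP => a b m; rewrite !cE act_lN -opprD -homphi -linearD.
    congr (- phi _); apply: gen_inj => i.
    have gD x y : gen (x + y) i = gen x i + gen y i := lin_D (gen_linear i) x y.
    rewrite gD gen_act !rel0E rmod_actM mulrBl -!fd_scalerAl mul1r addrA.
    by rewrite subrK.
  (* Every [x] is minus the sum of the relations [rel0 (e i) (gen x i)]: their multiples of 1 cancel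
     by [gen_rel]. *)
  suff -> : linfun Psi0 c = phi by rewrite subrr mem0v.
  apply/lfunP => x; rewrite PsiE; under eq_bigr do rewrite cE.
  rewrite sumrN -linear_sum -linearN; congr (phi _); apply: gen_inj => j.
  rewrite -scaleN1r (lin_Z (gen_linear j)) scaleN1r (lin_sum (gen_linear j)).
  under eq_bigr do rewrite rel0E.
  rewrite sumrB opprB -scaler_suml.
  rewrite -[\sum_i cf j _]linear_sum gen_rel linear0 scale0r subr0.
  rewrite (bigD1 j) //= big1 => [|i ij].
    by rewrite cf_basis eqxx scale1r addr0.
  by rewrite cf_basis eq_sym (negPf ij) scale0r.
Qed.

End ExtCocycles.

(** * Modules over A*G as A-modules with a commuting right action of G *)

Section TrivialAction.

Variables (gT : finGroupType) (k : fieldType) (A : fdAlgType k).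
Variables (act : alg_action gT A).
Hypothesis act_trivial : forall (g : gT) (a : A), act g a = a.
Local Notation B := (skew_group_alg act).

Definition actA (S : rmod B) (s : S) (a : A) : S :=
  rmod_act s (skew_elt act a 1%g).

Definition actG (S : rmod B) (s : S) (g : gT) : S :=
  rmod_act s (skew_elt act 1 g).

Definition gequiv (S S' : rmod B) (f : 'Hom(S, S')) : Prop :=
  forall s g, f (actG s g) = actG (f s) g.

Definition aequiv (S S' : rmod B) (f : 'Hom(S, S')) : Prop :=
  forall s a, f (actA s a) = actA (f s) a.

Lemma skew_elt_mul a g b h :
  (skew_elt act a g : B) * skew_elt act b h = skew_elt act (a * b) (g * h)%g.
Proof. by rewrite -[b in RHS](act_trivial g); apply: skew_mul_elt. Qed.

Lemma skew_elt_linear g : linear (skew_elt act ^~ g).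
Proof.
move=> c a b; apply/ffunP => h; rewrite !ffunE.
by case: ifP; rewrite // scaler0 addr0.
Qed.

Lemma skew_elt_sum (b : B) : b = \sum_g skew_elt act (b g) g.
Proof.
apply/ffunP => h; rewrite sum_ffunE (bigD1 h) //= big1 => [|g gh].
  by rewrite ffunE eqxx addr0.
by rewrite ffunE eq_sym (negPf gh).
Qed.

Section Action.

Variable S : rmod B.
Implicit Types (s : S) (a b : A) (g h : gT).

Lemma actA_linearl a : linear (fun s : S => actA s a).
Proof. exact: rmod_act_linearl. Qed.

Lemma actG_linear g : linear (fun s : S => actG s g).
Proof. exact: rmod_act_linearl. Qed.

Lemma actA_linearr s : linear (actA s).
Proof. by move=> c a b; rewrite /actA skew_elt_linear rmod_act_linearr. Qed.

Lemma actA1 s : actA s 1 = s.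
Proof. exact: rmod_act1. Qed.

Lemma actG1 s : actG s 1%g = s.
Proof. exact: rmod_act1. Qed.

Lemma actAM s a b : actA s (a * b) = actA (actA s a) b.
Proof. by rewrite /actA -rmod_actM skew_elt_mul mulg1. Qed.

Lemma actGM s g h : actG s (g * h)%g = actG (actG s g) h.
Proof. by rewrite /actG -rmod_actM skew_elt_mul mulr1. Qed.

Lemma actGK g : cancel (fun s : S => actG s g) (fun s => actG s g^-1%g).
Proof. by move=> s; rewrite -actGM mulgV actG1. Qed.

Lemma act_elt s a g : rmod_act s (skew_elt act a g) = actG (actA s a) g.
Proof. by rewrite /actA /actG -rmod_actM skew_elt_mul mulr1 mul1g. Qed.

Lemma actAG s a g : actA (actG s g) a = actG (actA s a) g.
Proof. by rewrite -act_elt /actA /actG -rmod_actM skew_elt_mul mul1r mulg1. Qed.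

Lemma act_skew s (b : B) : rmod_act s b = \sum_g actG (actA s (b g)) g.
Proof.
rewrite [in LHS](skew_elt_sum b) act_rsum.
by apply: eq_bigr => g _; apply: act_elt.
Qed.

End Action.

Lemma homAGP (S S' : rmod B) (f : 'Hom(S, S')) :
  f \in homA S S' <-> gequiv f /\ aequiv f.
Proof.
rewrite homAP; split=> [homf|[fG fA] s b]; first by split=> s b; apply: homf.
rewrite !act_skew linear_sum; apply: eq_bigr => g _.
by rewrite /= fG fA.
Qed.

(** The actions of A and G commute. Thus A-linearity of a G-map becomes an equality between G-maps,
    which can be tested on a compression. *)
Lemma gequiv_actA (S : rmod B) a : exists2 f : 'End(S),
  gequiv f & forall s, f s = actA s a.
Proof.
exists (linfun (fun s : S => actA s a)) => [s g|s];
  by rewrite !(linfunE (actA_linearl a)) // actAG.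
Qed.

Lemma gequiv_comp (S1 S2 S3 : rmod B) (f : 'Hom(S1, S2)) (g : 'Hom(S2, S3)) :
  gequiv f -> gequiv g -> gequiv (g \o f)%VF.
Proof. by move=> fG gG s x; rewrite !comp_lfunE fG gG. Qed.

(** * Averaging over G and normalized cocycles *)

Hypothesis card_neq0 : #|gT|%:R != 0 :> k.

Lemma gequiv_average (S S' : rmod B) (p : 'Hom(S, S')) :
  exists2 P : 'Hom(S, S'), gequiv P &
    forall s, P s = #|gT|%:R^-1 *: \sum_g actG (p (actG s g)) g^-1%g.
Proof.
pose P (s : S) := #|gT|%:R^-1 *: \sum_g actG (p (actG s g)) g^-1%g.
have linP : linear P.
  move=> c u v; rewrite /P scalerA mulrC -scalerA -scalerDr.
  congr (_ *: _); rewrite scaler_sumr -big_split /=; apply: eq_bigr => g _.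
  by rewrite actG_linear linearP actG_linear.
exists (linfun P) => [s x|s]; last exact: linfunE.
rewrite !(linfunE linP) /P (lin_Z (actG_linear x)) (lin_sum (actG_linear x)).
congr (_ *: _); rewrite [RHS](reindex_inj (mulgI x)) /=.
by apply: eq_bigr => g _; rewrite -!actGM invMg mulgKV.
Qed.

(** On G, [c] is a 1-cocycle of G with values in Hom_k(S, S'), and averaging splits it since |G| is
    invertible: [h] below is minus the mean of the maps s |-> c(g)(s) g^-1. *)
Lemma cocycle_normalize (S S' : rmod B) (c : 'Hom(B, 'Hom(S, S'))) :
  cocycle c -> exists2 d, coboundary d &
    forall g s, c (skew_elt act 1 g) s = d (skew_elt act 1 g) s.
Proof.
move=> cZ; pose cG g := c (skew_elt act 1 g).
have cGM x g s : cG g (actG s x) = cG (x * g)%g s - actG (cG x s) g.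
  by have := cZ (skew_elt act 1 x) (skew_elt act 1 g) s;
    rewrite skew_elt_mul mulr1 /cG => ->; rewrite addrK.
pose h s := - (#|gT|%:R^-1 *: \sum_g actG (cG g s) g^-1%g).
have lin_h : linear h.
  move=> y u v; rewrite /h scalerN -opprD scalerA mulrC -scalerA -scalerDr.
  congr (- (_ *: _)); rewrite scaler_sumr -big_split /=.
  by apply: eq_bigr => g _; rewrite linearP actG_linear.
have [d dE] := coboundary_hom (linfun h).
exists d => [|x s]; first by exists (linfun h).
rewrite dE !(linfunE lin_h) -!/(actG _ _) -/(cG x) /h.
rewrite (lin_N (actG_linear x)) (lin_Z (actG_linear x)) opprK.
rewrite (lin_sum (actG_linear x)).
under eq_bigr do rewrite cGM (lin_B (actG_linear _)) -actGM mulgV actG1.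
under [X in _ + _ *: X]eq_bigr do rewrite -actGM.
rewrite sumrB sumr_const -scaler_nat scalerBr scalerA.
rewrite [X in _ + _ *: X](reindex_inj (mulgI x)) /=.
under [X in _ + _ *: X]eq_bigr do rewrite invMg mulgKV.
by rewrite opprB subrK mulVf ?scale1r.
Qed.

(** The products of a and g in either order agree in A*G; compare the two cocycle identities. *)
Lemma cocycle_normal_gequiv (S S' : rmod B) (c : 'Hom(B, 'Hom(S, S'))) a :
  cocycle c -> (forall g s, c (skew_elt act 1 g) s = 0) ->
  gequiv (c (skew_elt act a 1%g)).
Proof.
move=> cZ c0 s g.
have := cZ (skew_elt act 1 g) (skew_elt act a 1%g) s.
have := cZ (skew_elt act a 1%g) (skew_elt act 1 g) s.
rewrite !skew_elt_mul mulr1 mul1r mulg1 mul1g !c0 => ->.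
by rewrite act_l0 add0r addr0.
Qed.

Lemma cocycle_normalE (S S' : rmod B) (c : 'Hom(B, 'Hom(S, S'))) b s :
  cocycle c -> (forall g s, c (skew_elt act 1 g) s = 0) ->
  c b s = \sum_g actG (c (skew_elt act (b g) 1%g) s) g.
Proof.
move=> cZ c0; rewrite [in LHS](skew_elt_sum b) linear_sum sum_lfunE.
apply: eq_bigr => g _ /=.
have := cZ (skew_elt act (b g) 1%g) (skew_elt act 1 g) s.
by rewrite !skew_elt_mul mulr1 mul1g c0 add0r.
Qed.

(** Converse to [cocycle_normal_gequiv]: the extension is given by the formula that
    [cocycle_normalE] forces, and equivariance of the values yields the cocycle identity. *)
Lemma cocycle_extend (S S' : rmod B) (c0 : 'Hom(A, 'Hom(S, S'))) :
  (forall a, gequiv (c0 a)) ->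
  (forall a b s, c0 (a * b) s = c0 b (actA s a) + actA (c0 a s) b) ->
  exists2 c : 'Hom(B, 'Hom(S, S')), cocycle c &
    forall a, c (skew_elt act a 1%g) = c0 a.
Proof.
move=> c0G c0M; pose F (b : B) s := \sum_g actG (c0 (b g) s) g.
have [c cE] : exists c : 'Hom(B, 'Hom(S, S')), forall b s, c b s = F b s.
  apply: bilinear_hom => [s|b] y u v; rewrite /F scaler_sumr -big_split /=;
    apply: eq_bigr => g _; rewrite -actG_linear.
    by rewrite !ffunE linearP add_lfunE scale_lfunE.
  by rewrite linearP.
exists c => [b b' s|a]; last first.
  apply/lfunP => s; rewrite cE /F (bigD1 1%g) //= big1 => [|g g1].
    by rewrite ffunE eqxx addr0 actG1.
  by rewrite ffunE (negPf g1) linear0 zero_lfunE (linear_fun0 (actG_linear g)).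
rewrite !cE !act_skew /F.
have -> : \sum_u actG (c0 ((b * b') u) s) u =
    \sum_h \sum_g actG (actG (c0 (b g * b' h) s) g) h.
  transitivity (\sum_u \sum_g actG (c0 (b g * b' (g^-1 * u)%g) s) u).
    apply: eq_bigr => u _; rewrite -(lin_sum (actG_linear u)) -sum_lfunE.
    rewrite -linear_sum; congr (actG (c0 _ s) u); rewrite ffunE.
    by apply: eq_bigr => g _; rewrite act_trivial.
  rewrite exchange_big [RHS]exchange_big /=; apply: eq_bigr => g _.
  rewrite (reindex_inj (mulgI g)) /=; apply: eq_bigr => h _.
  by rewrite mulKg actGM.
rewrite -big_split /=; apply: eq_bigr => h _.
rewrite linear_sum (lin_sum (actA_linearl _)) -(lin_D (actG_linear h)).
rewrite -big_split /= (lin_sum (actG_linear h)); apply: eq_bigr => g _.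
by rewrite c0M c0G actAG (lin_D (actG_linear g)).
Qed.

(** * Compressions, and the comparison of Hom and Ext^1 along them *)

(** T as a direct summand of S over A. It covers two cases: the image of an idempotent of kG, and an
    inflated module with its original. *)
Record compression (S : rmod B) (T : rmod A) := Compression {
  inc : 'Hom(T, S);
  prj : 'Hom(S, T);
  inc_act : forall t a, inc (rmod_act t a) = actA (inc t) a;
  prj_act : forall s a, prj (actA s a) = rmod_act (prj s) a;
  incK : forall t, prj (inc t) = t
}.

(* [f |-> prj f inc] is a bijection Hom_G(S, S') -> Hom_k(T, T'), and [f] maps
   the image of [T] into that of [T']. *)
Definition full_faithful (S S' : rmod B) (T T' : rmod A)
    (X : compression S T) (X' : compression S' T') : Prop :=
  [/\ forall f, gequiv f -> (forall t, prj X' (f (inc X t)) = 0) -> f = 0,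
      forall h : 'Hom(T, T'),
        exists2 f, gequiv f & forall t, prj X' (f (inc X t)) = h t
    & forall f, gequiv f ->
        forall t, inc X' (prj X' (f (inc X t))) = f (inc X t)].

Section Compression.

Variables (S S' : rmod B) (T T' : rmod A).
Variables (X : compression S T) (X' : compression S' T').
Hypothesis ffX : full_faithful X X'.

Let inj f f' : gequiv f -> gequiv f' ->
  (forall t, prj X' (f (inc X t)) = prj X' (f' (inc X t))) -> f = f'.
Proof.
move=> fG f'G ff'; have [injX _ _] := ffX.
apply/subr0_eq/injX => [s g|t].
  by rewrite !(add_lfunE, opp_lfunE) fG f'G (lin_B (actG_linear g)).
by rewrite add_lfunE opp_lfunE linearB /= ff' subrr.
Qed.

Lemma compression_hom_surj (h : 'Hom(T, T')) : h \in homA T T' ->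
  exists2 f, f \in homA S S' & forall t, prj X' (f (inc X t)) = h t.
Proof.
move=> /homAP hA; have [_ surjX _] := ffX; have [f fG fE] := surjX h.
exists f => //; apply/homAGP; split=> // s a.
have [u uG uE] := gequiv_actA S a; have [u' u'G u'E] := gequiv_actA S' a.
suff /lfunP/(_ s) : (f \o u = u' \o f)%VF by rewrite !comp_lfunE uE u'E.
apply: inj => [||t]; try exact: gequiv_comp.
by rewrite !comp_lfunE uE u'E -inc_act prj_act !fE hA.
Qed.

Lemma compression_hom (f : 'Hom(S, S')) : f \in homA S S' ->
  (prj X' \o f \o inc X)%VF \in homA T T'.
Proof.
move=> /homAGP[_ fA]; apply/homAP => t a.
by rewrite !comp_lfunE inc_act fA prj_act.
Qed.

Lemma compression_hom_inj (f f' : 'Hom(S, S')) :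
  f \in homA S S' -> f' \in homA S S' ->
  (forall t, prj X' (f (inc X t)) = prj X' (f' (inc X t))) -> f = f'.
Proof. by move=> /homAGP[fG _] /homAGP[f'G _]; apply: inj. Qed.

(** Restrict cocycles to A and compress their values. Modulo coboundaries nothing is lost, since a
    cocycle vanishing on G has G-equivariant values on A, and these correspond to maps T -> T'. *)
Lemma compression_ext : ext1_dim S S' = ext1_dim T T'.
Proof.
have [injX surjX incX] := ffX.
have [Z ZP] := cocycle_space S S'; have [D DP] := coboundary_space S S'.
have [Z' Z'P] := cocycle_space T T'; have [D' D'P] := coboundary_space T T'.
rewrite (ext1_dimE ZP DP) (ext1_dimE Z'P D'P).
have [Phi PhiE] : exists Phi : 'Hom('Hom(B, 'Hom(S, S')), 'Hom(A, 'Hom(T, T'))),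
    forall c a t, Phi c a t = prj X' (c (skew_elt act a 1%g) (inc X t)).
  have compr (c : 'Hom(B, 'Hom(S, S'))) : exists c' : 'Hom(A, 'Hom(T, T')),
      forall a t, c' a t = prj X' (c (skew_elt act a 1%g) (inc X t)).
    apply: (bilinear_hom
      (F := fun a t => prj X' (c (skew_elt act a 1%g) (inc X t)))).
      move=> t y a b; rewrite skew_elt_linear !linearP add_lfunE scale_lfunE.
      by rewrite linearP.
    by move=> a y t u; rewrite !linearP.
  have [Phi PhiE] := choice compr.
  have lin : linear Phi.
    move=> y c d; apply/lfunP => a; apply/lfunP => t.
    by rewrite !(add_lfunE, scale_lfunE) !PhiE !(add_lfunE, scale_lfunE) linearP.
  by exists (linfun Phi) => c a t; rewrite linfunE.
have DZ c : coboundary c -> c \in Z by move/coboundary_cocycle/ZP.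
have PhiD c : c \in D -> Phi c \in D'.
  move=> /DP[h hE]; apply/D'P; exists (prj X' \o h \o inc X)%VF => a t.
  by rewrite PhiE hE !comp_lfunE inc_act linearB /= -/(actA _ _) prj_act.
apply: (@dim_quotient_eq _ _ _ Phi) => //.
- by apply/subvP => c /DP/DZ.
- by apply/subvP => c /D'P/coboundary_cocycle/Z'P.
- move=> c /ZP cZ; apply/Z'P => a b t; rewrite !PhiE inc_act.
  have := cZ (skew_elt act a 1%g) (skew_elt act b 1%g) (inc X t).
  by rewrite skew_elt_mul mulg1 => ->; rewrite linearD /= -!/(actA _ _) prj_act.
- move=> c cZ /D'P[h hE].
  have [d dD cd] := cocycle_normalize ((ZP c).1 cZ).
  have [c1 c1D] : exists c1, c1 = c - d by exists (c - d).
  have c1Z : cocycle c1 by apply/ZP; rewrite c1D rpredB // DZ.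
  have c1N g s : c1 (skew_elt act 1 g) s = 0.
    by rewrite c1D add_lfunE opp_lfunE add_lfunE opp_lfunE cd subrr.
  have : Phi c1 \in D'.
    rewrite c1D linearB rpredB //; first by apply/D'P; exists h.
    by apply/PhiD/DP.
  (* Lift the map [h1] bounding [Phi c1] to a G-map [f]. The coboundary of [f] agrees with [c1] on
     A, both being G-equivariant with the same compression, hence on A*G. *)
  move=> /D'P[h1 h1E]; have [f fG fE] := surjX h1.
  have fS t : f (inc X t) = inc X' (h1 t) by rewrite -fE incX.
  have c1E a s : c1 (skew_elt act a 1%g) s = f (actA s a) - actA (f s) a.
    have [u uG uE] := gequiv_actA S a; have [u' u'G u'E] := gequiv_actA S' a.
    suff /lfunP/(_ s) : c1 (skew_elt act a 1%g) = (f \o u)%VF - (u' \o f)%VF.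
      by rewrite add_lfunE opp_lfunE !comp_lfunE uE u'E.
    apply: inj; first exact: cocycle_normal_gequiv.
      move=> x g; rewrite !(add_lfunE, opp_lfunE) !gequiv_comp //.
      by rewrite (lin_B (actG_linear g)).
    move=> t; rewrite -PhiE h1E !(add_lfunE, opp_lfunE) !comp_lfunE uE u'E.
    by rewrite linearB /= -inc_act !fS -inc_act !incK.
  have -> : c = c1 + d by rewrite c1D subrK.
  apply: rpredD; last exact/DP.
  apply/DP; exists f => b s; rewrite cocycle_normalE // !act_skew linear_sum.
  rewrite -sumrB; apply: eq_bigr => g _ /=.
  by rewrite c1E fG (lin_B (actG_linear g)).
move=> c' /Z'P c'Z.
(* Lift the values of [c'] one by one to G-maps; uniqueness of lifts makes [F] linear and gives the
   cocycle identity. *)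
have /choice[F FE] a : exists f, gequiv f /\
    forall t, prj X' (f (inc X t)) = c' a t.
  by have [f] := surjX (c' a); exists f.
have FG a := (FE a).1; have {}FE a := (FE a).2.
have FS a t : F a (inc X t) = inc X' (c' a t) by rewrite -FE incX.
have linF : linear F.
  move=> y a b; apply: inj => [//|s g|t]; rewrite !(add_lfunE, scale_lfunE).
    by rewrite !FG actG_linear.
  by rewrite FE linearP add_lfunE scale_lfunE [RHS]linearP /= -!FE.
have FM a b s : F (a * b) s = F b (actA s a) + actA (F a s) b.
  have [u uG uE] := gequiv_actA S a; have [u' u'G u'E] := gequiv_actA S' b.
  suff /lfunP/(_ s) : F (a * b) = (F b \o u)%VF + (u' \o F a)%VF.
    by rewrite add_lfunE !comp_lfunE uE u'E.
  apply: inj => // [x g|t].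
    by rewrite !add_lfunE !gequiv_comp // (lin_D (actG_linear g)).
  rewrite add_lfunE !comp_lfunE uE u'E linearD /= -inc_act prj_act !FE.
  exact: c'Z.
have linFE a : linfun F a = F a := linfunE linF a.
have [||c cZ cE] := @cocycle_extend S S' (linfun F).
- by move=> a; rewrite linFE.
- by move=> a b s; rewrite !linFE.
exists c; first exact/ZP.
rewrite (_ : Phi c = c') ?subrr ?mem0v //.
by apply/lfunP => a; apply/lfunP => t; rewrite PhiE cE linFE FE.
Qed.

End Compression.

(** Once normalized, a cocycle takes G-equivariant values on A, hence vanishes there, and with it on
    all of A*G. *)
Lemma ext1_dim_gequiv0 (S S' : rmod B) :
  (forall f : 'Hom(S, S'), gequiv f -> f = 0) -> ext1_dim S S' = 0%N.
Proof.
move=> f0; have [Z ZP] := cocycle_space S S'.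
have [D DP] := coboundary_space S S'.
rewrite (ext1_dimE ZP DP); apply/eqP; rewrite subn_eq0; apply/dimvS/subvP.
move=> c cZ; have [d dD cd] := cocycle_normalize ((ZP c).1 cZ).
have [c1 c1D] : exists c1, c1 = c - d by exists (c - d).
have c1Z : cocycle c1.
  by apply/ZP; rewrite c1D rpredB //; apply/ZP/coboundary_cocycle.
have c1N g s : c1 (skew_elt act 1 g) s = 0.
  by rewrite c1D add_lfunE opp_lfunE add_lfunE opp_lfunE cd subrr.
suff -> : c = d by apply/DP.
apply/eqP; rewrite -subr_eq0 -c1D; apply/eqP/lfunP => b; apply/lfunP => s.
rewrite cocycle_normalE // !zero_lfunE big1 // => g _.
rewrite (f0 _ (cocycle_normal_gequiv _ c1Z c1N)) zero_lfunE.
exact: (linear_fun0 (actG_linear g)).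
Qed.

(** * Operators from the group algebra and their annihilation of bricks *)

Lemma gequiv_proj (S : rmod B) (U : {vspace S}) :
  (forall u g, u \in U -> actG u g \in U) ->
  exists P : 'End(S), [/\ gequiv P, forall s, P s \in U
    & forall u, u \in U -> P u = u].
Proof.
move=> Ust; have [P PG PE] := gequiv_average (projv U).
exists P; split=> // [s|u uU]; rewrite PE.
  by apply/rpredZ/rpred_sum => g _; apply/Ust/memv_proj.
under eq_bigr do rewrite projv_id ?Ust // actGK.
by rewrite sumr_const -scaler_nat scalerA mulVf ?scale1r.
Qed.

(* A natural family of G-linear operators, i.e., an element of the group
   algebra, without reference to the latter. *)
Record natop := NatOp {
  natop_fun :> forall S : rmod B, 'End(S);
  natopP : forall (S S' : rmod B) (f : 'Hom(S, S')), gequiv f ->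
    forall s, f (natop_fun S s) = natop_fun S' (f s)
}.

Lemma natop_group g : exists u : natop,
  forall (S : rmod B) (s : S), u S s = actG s g.
Proof.
have actGE (S : rmod B) s : linfun (fun s : S => actG s g) s = actG s g.
  exact: (linfunE (actG_linear g)).
have nat (S S' : rmod B) (f : 'Hom(S, S')) : gequiv f -> forall s,
    f (linfun (fun s : S => actG s g) s) = linfun (fun s : S' => actG s g) (f s).
  by move=> fG s; rewrite !actGE fG.
by exists (NatOp nat).
Qed.

Lemma natop_comp (u v : natop) : exists w : natop,
  forall (S : rmod B) (s : S), w S s = u S (v S s).
Proof.
have nat (S S' : rmod B) (f : 'Hom(S, S')) : gequiv f -> forall s,
    f ((u S \o v S)%VF s) = (u S' \o v S')%VF (f s).
  by move=> fG s; rewrite !comp_lfunE (natopP u fG) (natopP v fG).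
by exists (NatOp nat) => S s; rewrite comp_lfunE.
Qed.

Lemma natop_lin (u v : natop) c : exists w : natop,
  forall (S : rmod B) (s : S), w S s = c *: u S s + v S s.
Proof.
have nat (S S' : rmod B) (f : 'Hom(S, S')) : gequiv f -> forall s,
    f ((c *: u S + v S) s) = (c *: u S' + v S') (f s).
  by move=> fG s; rewrite !(add_lfunE, scale_lfunE) linearP /=
    (natopP u fG) (natopP v fG).
by exists (NatOp nat) => S s; rewrite !(add_lfunE, scale_lfunE).
Qed.

Lemma natop_scale (u : natop) c : exists w : natop,
  forall (S : rmod B) (s : S), w S s = c *: u S s.
Proof.
have nat (S S' : rmod B) (f : 'Hom(S, S')) : gequiv f -> forall s,
    f ((c *: u S) s) = (c *: u S') (f s).
  by move=> fG s; rewrite !scale_lfunE linearZ /= (natopP u fG).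
by exists (NatOp nat) => S s; rewrite scale_lfunE.
Qed.

Lemma natop_actA (u : natop) (S : rmod B) (s : S) a :
  u S (actA s a) = actA (u S s) a.
Proof. by have [f fG fE] := gequiv_actA S a; rewrite -!fE (natopP u fG). Qed.

(* [K] is the largest submodule killed by [u] and [L] the submodule generated
   by the image of [u].  A G-linear projection onto [K] kills [L], which makes
   S the direct sum of [K] and [L]; so one of them vanishes when S is a brick. *)
Lemma brick_dichotomy (S : rmod B) (u : natop) : brick S -> u S != 0 ->
  (forall s, (forall g, u S (actG s g) = 0) -> s = 0) /\
  (forall s, exists t : gT -> S, s = \sum_g actG (u S (t g)) g).
Proof.
move=> [_ brickS] u0.
have [K KP] : exists K : {vspace S}, forall s,
    s \in K <-> forall g, u S (actG s g) = 0.
  apply: subspace_vspace => [g|c s t sK tK g].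
    by rewrite (linear_fun0 (actG_linear g)) linear0.
  by rewrite actG_linear linearP /= sK tK scaler0 addr0.
have [L LP] : exists L : {vspace S}, forall s,
    s \in L <-> exists t : gT -> S, s = \sum_g actG (u S (t g)) g.
  apply: subspace_vspace => [|c s s' [t ->] [t' ->]].
    exists (fun=> 0); rewrite big1 // => g _.
    by rewrite linear0 (linear_fun0 (actG_linear g)).
  exists (fun g => c *: t g + t' g); rewrite scaler_sumr -big_split /=.
  by apply: eq_bigr => g _; rewrite linearP actG_linear.
have Kst s g : s \in K -> actG s g \in K.
  by move=> /KP sK; apply/KP => h; rewrite -actGM.
have KstA s a : s \in K -> actA s a \in K.
  move=> /KP sK; apply/KP => h; rewrite -actAG natop_actA sK.
  exact: (linear_fun0 (actA_linearl a)).
have Lst s g : s \in L -> actG s g \in L.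
  move=> /LP[t ->]; apply/LP; exists (fun h => t (h * g^-1)%g).
  rewrite (lin_sum (actG_linear g)) [RHS](reindex_inj (mulIg g)) /=.
  by apply: eq_bigr => h _; rewrite mulgK actGM.
have LstA s a : s \in L -> actA s a \in L.
  move=> /LP[t ->]; apply/LP; exists (fun h => actA (t h) a).
  rewrite (lin_sum (actA_linearl a)).
  by apply: eq_bigr => h _; rewrite actAG natop_actA.
have uL s : u S s \in L.
  apply/LP; exists (fun g => if g == 1%g then s else 0).
  rewrite (bigD1 1%g) //= big1 => [|g g1]; first by rewrite eqxx actG1 addr0.
  by rewrite (negPf g1) linear0 (linear_fun0 (actG_linear g)).
have [P [PG PK Pid]] := gequiv_proj Kst; have [Q [QG QL Qid]] := gequiv_proj Lst.
have PL s : s \in L -> P s = 0.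
  move=> /LP[t ->]; rewrite linear_sum big1 // => g _ /=.
  rewrite PG (natopP u PG); have /KP/(_ 1%g) := PK (t g); rewrite actG1 => ->.
  exact: (linear_fun0 (actG_linear g)).
(* The remainder lies in [K], since [u] takes values in [L], which [P] kills and [Q] fixes; [P] then
   both fixes and kills it. *)
have PQ s : s = P s + Q s.
  have RK : s - (P s + Q s) \in K.
    apply/KP => g; rewrite (lin_B (actG_linear g)) (lin_D (actG_linear g)).
    rewrite -PG -QG linearB linearD /= -(natopP u PG) -(natopP u QG).
    rewrite PL // Qid //.
    by rewrite add0r subrr.
  apply/eqP; rewrite -subr_eq0 -(Pid _ RK) linearB linearD /=.
  by rewrite (PL (Q s)) // addr0 (Pid (P s)) // subrr.
(* [P] is the projection onto [K] along [L], and both are stable under A. *)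
have Phom : P \in homA S S.
  apply/homAGP; split=> // s a.
  rewrite [in LHS](PQ s) (lin_D (actA_linearl a)) linearD /=.
  by rewrite (PL (actA (Q s) a)) ?LstA // Pid ?KstA ?addr0.
have [P0|/eqP Pn0] := pselect (P = 0).
  split=> s; first by move=> /KP/Pid <-; rewrite P0 zero_lfunE.
  by apply/LP; rewrite (PQ s) P0 zero_lfunE add0r.
(* A nonzero [P] is invertible and idempotent, hence the identity; then [K] is everything and [u]
   vanishes on S. *)
have [f [_ fP _]] := brickS P Phom Pn0; case/eqP: u0; apply/lfunP => s.
have Ps : P s = s.
  by have /lfunP/(_ (P s)) := fP; have /lfunP/(_ s) := fP;
    rewrite !comp_lfunE !id_lfunE (Pid (P s)) // => {1}->.
by have /KP/(_ 1%g) := PK s; rewrite Ps actG1 zero_lfunE.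
Qed.

(** If [u] kills S but not S', then [u] kills the G-orbits of the image of [f], so this image is 0.
    If [u] kills S' but not S, then the image of [u] generates S under G and [f] kills it. *)
Lemma brick_annihilator (S S' : rmod B) (f : 'Hom(S, S')) :
  brick S -> brick S' -> gequiv f -> f != 0 ->
  forall u : natop, u S = 0 <-> u S' = 0.
Proof.
move=> bS bS' fG f0 u; split=> u0; apply/eqP; apply: contra_neqT f0 => u'0.
  have [K0 _] := brick_dichotomy bS' u'0; apply/lfunP => s.
  rewrite zero_lfunE; apply: K0 => g.
  by rewrite -fG -(natopP u fG) u0 zero_lfunE linear0.
have [_ Lf] := brick_dichotomy bS u'0; apply/lfunP => s.
have [t ->] := Lf s; rewrite linear_sum zero_lfunE big1 // => g _ /=.
by rewrite fG (natopP u fG) u0 zero_lfunE (linear_fun0 (actG_linear g)).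
Qed.

(* The idempotent [e] is primitive on [S]: [e kG e = k e]. *)
Definition primitive_on (e : natop) (mu : gT -> k) (S : rmod B) : Prop :=
  [/\ e S != 0, forall s, e S (e S s) = e S s
    & forall s g, e S (actG (e S s) g) = mu g *: e S s].

(** Each condition says whether some element of the group algebra, such as e e - e or e g e - mu(g)
    e, kills the module. *)
Lemma primitive_on_annihilator (e : natop) (mu : gT -> k) (S S' : rmod B) :
  (forall u : natop, u S = 0 <-> u S' = 0) ->
  primitive_on e mu S -> primitive_on e mu S'.
Proof.
move=> ann [e0 ee eg]; split.
- by apply: contra_neq e0 => /ann.
- have [e2 e2E] := natop_comp e e; have [u uE] := natop_lin e e2 (-1).
  have /ann/lfunP u0 : u S = 0.
    by apply/lfunP => s; rewrite uE e2E ee scaleN1r addNr zero_lfunE.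
  move=> s; have := u0 s; rewrite uE e2E zero_lfunE scaleN1r addrC => /eqP.
  by rewrite subr_eq0 => /eqP.
- move=> s g; have [v vE] := natop_group g.
  have [ve veE] := natop_comp v e; have [eve eveE] := natop_comp e ve.
  have [u uE] := natop_lin e eve (- mu g).
  have /ann/lfunP u0 : u S = 0.
    by apply/lfunP => t; rewrite uE eveE veE vE eg scaleNr addNr zero_lfunE.
  have := u0 s; rewrite uE eveE veE vE zero_lfunE scaleNr addrC => /eqP.
  by rewrite subr_eq0 => /eqP.
Qed.

(** * The A-module cut out of S by an idempotent of the group algebra *)

Section Corner.

Variables (e : natop) (S : rmod B).
Hypothesis ee : forall s, e S (e S s) = e S s.

Definition restr_rmod : rmod A :=
  RMod (@actA_linearl S) (@actA_linearr S) (@actA1 S) (@actAM S).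

Lemma corner_stable (u : restr_rmod) a : u \in (limg (e S) : {vspace restr_rmod}) ->
  rmod_act u a \in (limg (e S) : {vspace restr_rmod}).
Proof.
move=> /memv_imgP[s _ ->]; rewrite -[rmod_act _ _]/(actA (e S s) a) -natop_actA.
by rewrite memv_img ?memvf.
Qed.

Lemma corner : exists (T : rmod A) (X : compression S T),
  (forall t, e S (inc X t) = inc X t) /\ (forall s, inc X (prj X s) = e S s).
Proof.
pose T := sub_rmod corner_stable.
pose i : 'Hom(T, S) := linfun (@vsval k S (limg (e S))).
pose p : 'Hom(S, T) := (linfun (@vsproj k S (limg (e S))) \o e S)%VF.
have iE t : i t = vsval t by rewrite lfunE.
have ip s : i (p s) = e S s.
  by rewrite iE comp_lfunE lfunE /= vsprojK // memv_img ?memvf.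
have ei t : e S (i t) = i t.
  by have /memv_imgP[s _] := subvsP t; rewrite -iE => ->; rewrite ee.
have i_inj : injective i by move=> t u; rewrite !iE => /val_inj.
have pi t : p (i t) = t by apply: i_inj; rewrite ip ei.
have iact t a : i (rmod_act t a) = actA (i t) a.
  by rewrite !iE; apply: (sub_actE corner_stable).
exists T; unshelve eexists (@Compression S T i p iact _ pi); last by split.
by move=> s a; apply: i_inj; rewrite iact !ip natop_actA.
Qed.

End Corner.

(* With [m t = \sum_g (t g) e g], every element of S is some [m t], and
   [m t = 0] forces [\sum_g h (t g) g = 0] since [e] is primitive; so [h]
   extends to a G-linear map. *)
Lemma corner_extend (e : natop) (mu : gT -> k) (S S' : rmod B)
    (h : 'Hom(S, S')) : brick S -> brick S' ->
  primitive_on e mu S -> primitive_on e mu S' ->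
  (forall s, h (e S s) = h s) -> (forall s, e S' (h s) = h s) ->
  exists2 f : 'Hom(S, S'), gequiv f & forall s, f (e S s) = h s.
Proof.
move=> bS bS' [e0 ee eg] [e'0 e'e e'g] he eh.
have [_ surj] := brick_dichotomy bS e0; have [K0 _] := brick_dichotomy bS' e'0.
pose V : vectType k := {ffun gT -> S}.
have lin_m : linear (fun t : V => \sum_g actG (e S (t g)) g).
  by apply: linear_sum_fun => g c u v; rewrite !ffunE linearP actG_linear.
have lin_m' : linear (fun t : V => \sum_g actG (h (t g)) g).
  by apply: linear_sum_fun => g c u v; rewrite !ffunE linearP actG_linear.
pose m : 'Hom(V, S) := linfun (fun t : V => \sum_g actG (e S (t g)) g).
pose m' : 'Hom(V, S') := linfun (fun t : V => \sum_g actG (h (t g)) g).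
have mE t : m t = \sum_g actG (e S (t g)) g := linfunE lin_m t.
have m'E t : m' t = \sum_g actG (h (t g)) g := linfunE lin_m' t.
(* By [K0] it suffices that [e] kills every translate of [m' t]. By primitivity this is the same
   combination, with scalars mu(g x), as [h] applied to e(m(t) x) = 0. *)
have m'0 t : m t = 0 -> m' t = 0.
  move=> mt0; apply: K0 => x; rewrite m'E (lin_sum (actG_linear x)) linear_sum.
  have: h (\sum_g e S (actG (actG (e S (t g)) g) x)) = 0.
    rewrite -linear_sum -(lin_sum (actG_linear x)) -mE mt0.
    by rewrite (linear_fun0 (actG_linear x)) !linear0.
  rewrite linear_sum => h0; rewrite -[RHS]h0; apply: eq_bigr => g _ /=.
  by rewrite -!actGM eg -(eh (t g)) e'g linearZ /= he eh.
(* [m^-1] is only a linear section of [m]; [m'0] makes the choice harmless. *)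
pose f := (m' \o m^-1)%VF.
have fm t : f (m t) = m' t.
  rewrite comp_lfunE; apply/eqP; rewrite -subr_eq0 -linearB; apply/eqP/m'0.
  by rewrite linearB /= limg_lfunVK ?subrr // memv_img ?memvf.
have surj_m s : exists t, m t = s.
  have [t ->] := surj s; exists [ffun g => t g]; rewrite mE.
  by apply: eq_bigr => g _; rewrite ffunE.
exists f => [s x|s].
  have [t <-] := surj_m s; rewrite fm mE m'E !(lin_sum (actG_linear x)).
  have -> : \sum_g actG (actG (e S (t g)) g) x =
      m [ffun g => t (g * x^-1)%g].
    rewrite mE [RHS](reindex_inj (mulIg x)) /=.
    by apply: eq_bigr => g _; rewrite ffunE mulgK actGM.
  rewrite fm m'E (reindex_inj (mulIg x)) /=.
  by apply: eq_bigr => g _; rewrite ffunE mulgK actGM.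
(* The family concentrated at 1 represents [e S s], where [f] must equal [h s]. *)
have delta (U : rmod B) (F : S -> U) : F 0 = 0 ->
    \sum_g actG (F ([ffun g => if g == 1%g then s else 0] g)) g = F s.
  move=> F0; rewrite (bigD1 1%g) //= big1 => [|g g1].
    by rewrite ffunE eqxx actG1 addr0.
  by rewrite ffunE (negPf g1) F0 (linear_fun0 (actG_linear g)).
have <- : m [ffun g => if g == 1%g then s else 0] = e S s.
  by rewrite mE (delta S (e S)) ?linear0.
by rewrite fm m'E (delta S' h) ?linear0.
Qed.

(** A G-map commutes with [e], so it preserves the images of [e]; it is determined there because the
    image of [e] generates S under G. Existence is [corner_extend]. *)
Lemma corner_full_faithful (e : natop) (mu : gT -> k) (S S' : rmod B)
    (T T' : rmod A) (X : compression S T) (X' : compression S' T') :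
  brick S -> brick S' -> primitive_on e mu S -> primitive_on e mu S' ->
  (forall t, e S (inc X t) = inc X t) -> (forall s, inc X (prj X s) = e S s) ->
  (forall t, e S' (inc X' t) = inc X' t) ->
  (forall s, inc X' (prj X' s) = e S' s) ->
  full_faithful X X'.
Proof.
move=> bS bS' pS pS' ei ie ei' ie'.
have incf (f : 'Hom(S, S')) : gequiv f ->
    forall t, inc X' (prj X' (f (inc X t))) = f (inc X t).
  by move=> fG t; rewrite ie' -(natopP e fG) ei.
have [e0 _ _] := pS; have [_ surj] := brick_dichotomy bS e0.
split=> // [f fG f0|h].
  apply/lfunP => s; have [t ->] := surj s; rewrite linear_sum zero_lfunE big1 //.
  move=> g _ /=; rewrite fG -ie -incf // f0 linear0.
  exact: (linear_fun0 (actG_linear g)).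
have [||f fG fE] := @corner_extend e mu S S' (inc X' \o h \o prj X)%VF bS bS' pS pS'.
- by move=> s; rewrite !comp_lfunE -ie incK.
- by move=> s; rewrite !comp_lfunE ei'.
by exists f => // t; rewrite -ei fE !comp_lfunE !incK.
Qed.

(** Compression identifies the two endomorphism algebras, so the identity being nonzero and the
    existence of inverses pass both ways. *)
Lemma compression_brick (S : rmod B) (T : rmod A) (X : compression S T) :
  full_faithful X X -> brick S <-> brick T.
Proof.
move=> ffX; have [injX surjX incX] := ffX.
have id1 : (\1%VF : 'End(S)) \in homA S S by apply/homAP => s b; rewrite !id_lfunE.
have comp (f g : 'End(S)) : f \in homA S S -> g \in homA S S ->
    (g \o f)%VF \in homA S S.
  move=> /homAP fA /homAP gA; apply/homAP => s b.
  by rewrite !comp_lfunE fA gA.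
have inc_inj : injective (inc X) := can_inj (incK X).
split=> -[one0 inv]; split.
- apply: contraNneq one0 => T0; apply/eqP/injX => [s g|t].
    by rewrite !id_lfunE.
  by rewrite id_lfunE incK; have /lfunP/(_ t) := T0; rewrite id_lfunE zero_lfunE.
- move=> h hA h0; have [f fA fE] := compression_hom_surj ffX hA.
  have f0 : f != 0.
    apply: contraNneq h0 => f0; apply/eqP/lfunP => t.
    by rewrite -fE f0 !zero_lfunE linear0.
  have [g [gA gf fg]] := inv f fA f0.
  have /homAGP[fG _] := fA; have /homAGP[gG _] := gA.
  exists (prj X \o g \o inc X)%VF; split; first exact: compression_hom.
    apply/lfunP => t; rewrite !comp_lfunE id_lfunE -fE incX //.
    by have /lfunP/(_ (inc X t)) := gf; rewrite comp_lfunE id_lfunE => ->;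
      rewrite incK.
  apply/lfunP => t; rewrite !comp_lfunE id_lfunE -fE incX //.
  by have /lfunP/(_ (inc X t)) := fg; rewrite comp_lfunE id_lfunE => ->;
      rewrite incK.
- apply: contraNneq one0 => S0; apply/eqP/lfunP => t; apply: inc_inj.
  by have /lfunP/(_ (inc X t)) := S0; rewrite !id_lfunE !zero_lfunE linear0.
- move=> f fA f0; have /homAGP[fG _] := fA.
  have [|h [hA hf fh]] := inv _ (compression_hom X X fA).
    apply: contraNneq f0 => h0; apply/eqP/injX => // t.
    by have /lfunP/(_ t) := h0; rewrite !comp_lfunE zero_lfunE.
  have [g gA gE] := compression_hom_surj ffX hA; have /homAGP[gG _] := gA.
  exists g; split=> //; apply: (compression_hom_inj ffX); rewrite ?comp // => t.
    rewrite comp_lfunE id_lfunE incK -incX // gE.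
    by have /lfunP/(_ t) := hf; rewrite !comp_lfunE id_lfunE.
  rewrite comp_lfunE id_lfunE incK -(incX g) // gE.
  by have /lfunP/(_ t) := fh; rewrite !comp_lfunE id_lfunE.
Qed.

Lemma compression_hom0 (S S' : rmod B) (T T' : rmod A)
    (X : compression S T) (X' : compression S' T') :
  full_faithful X X' -> homA S S' = 0%VS <-> homA T T' = 0%VS.
Proof.
move=> ffX; have [injX _ _] := ffX.
split=> h0; apply/eqP; rewrite -subv0; apply/subvP => f.
  move=> /(compression_hom_surj ffX)[f']; rewrite h0 !memv0 => /eqP-> fE.
  by apply/eqP/lfunP => t; rewrite -fE !zero_lfunE linear0.
move=> fA; have := compression_hom X X' fA; rewrite h0 !memv0 => /eqP/lfunP f0.
have /homAGP[fG _] := fA.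
apply/eqP/injX => // t.
by have := f0 t; rewrite !comp_lfunE zero_lfunE.
Qed.

End TrivialAction.

(** * Primitive idempotents over an algebraically closed field *)

Section Primitive.

Variables (k : closedFieldType).

(** The characteristic polynomial of the restriction to W has degree dim W > 0, hence a root. *)
Lemma eigenvector_exists (V : vectType k) (W : {vspace V}) (f : 'End(V)) :
  W != 0%VS -> (forall w, w \in W -> f w \in W) ->
  exists w c, [/\ w \in W, w != 0 & f w = c *: w].
Proof.
move=> W0 fW.
pose f' : 'End(subvs_of W) :=
  (linfun (@vsproj k V W) \o f \o linfun (@vsval k V W))%VF.
have f'E w : vsval (f' w) = f (vsval w).
  by rewrite !comp_lfunE !lfunE /= vsprojK // fW ?subvsP.
have bas := vbasisP {:subvs_of W}.
pose M := passmx.mxof (vbasis {:subvs_of W}) (vbasis {:subvs_of W}) f'.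
have [c] : exists c, root (char_poly M) c.
  apply/closed_rootP; rewrite size_char_poly dimvf eqSS.
  by apply: contra W0; rewrite -[dim _]/(\dim W) dimv_eq0.
rewrite -eigenvalue_root_char => /eigenvalueP[v vM v0].
exists (vsval (passmx.vecof (vbasis {:subvs_of W}) v)), c; split.
- exact: subvsP.
- apply: contra_neq v0 => w0; apply/eqP.
  rewrite -(passmx.vecof_eq0 bas); apply/eqP/val_inj.
  by rewrite [LHS]w0 [RHS](linear0 vsval).
rewrite -f'E (passmx.hom_vecof _ bas) vM.
by rewrite (lin_Z (passmx.vecof_linear _)) (lin_Z (linearP vsval)).
Qed.

End Primitive.

Section ClosedField.

Variables (gT : finGroupType) (k : closedFieldType) (A : fdAlgType k).
Variables (act : alg_action gT A).
Hypothesis act_trivial : forall (g : gT) (a : A), act g a = a.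
Hypothesis card_neq0 : #|gT|%:R != 0 :> k.
Local Notation B := (skew_group_alg act).

(* Take [e] of minimal nonzero rank on S.  On the image of [e], the operator
   [g e] has an eigenvalue [c]; then [e g e - c e] has smaller rank, so it
   vanishes on S. *)
Lemma primitive_exists (S : rmod B) : brick S ->
  exists (e : natop act) (mu : gT -> k), primitive_on e mu S.
Proof.
move=> bS.
pose Q r := `[< exists2 u : natop act, \dim (limg (u S)) = r & u S != 0 >].
have Q0 : exists r, Q r.
  have [u uE] := natop_group act 1%g; exists (\dim (limg (u S))).
  apply/asboolP; exists u => //; have [id0 _] := bS.
  apply: contraNneq id0 => u0; apply/eqP/lfunP => s.
  by rewrite -u0 uE id_lfunE actG1.
have [r /asboolP[e re e0] rmin] := ex_minnP Q0.
have eig g : exists c, forall s, e S (actG (e S s) g) = c *: e S s.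
  have [v vE] := natop_group act g; have [w wE] := natop_comp e v.
  have W0 : limg (e S) != 0%VS.
    apply: contraNneq e0 => W0; apply/eqP/lfunP => s.
    by apply/eqP; rewrite zero_lfunE -memv0 -W0 memv_img ?memvf.
  have [|x [c [xW x0 wx]]] := @eigenvector_exists k S _ (w S) W0.
    by move=> x _; rewrite wE memv_img ?memvf.
  have [we weE] := natop_comp w e; have [u uE] := natop_lin e we (- c).
  exists c => s; apply/eqP; rewrite -vE -wE -weE -subr_eq0.
  rewrite addrC -scaleNr -uE; apply/eqP.
  suff /lfunP/(_ s) : u S = 0 by rewrite zero_lfunE.
  apply/eqP; apply: contraT => u0.
  have := rmin _ (asboolT (ex_intro2 _ _ u erefl u0)).
  rewrite -re leqNgt => /negP[].
  pose f : 'End(S) := w S - c *: \1%VF.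
  have -> : limg (u S) = (f @: limg (e S))%VS.
    rewrite -limg_comp; congr (limg _); apply/lfunP => t.
    rewrite uE weE comp_lfunE add_lfunE opp_lfunE scale_lfunE id_lfunE.
    by rewrite addrC scaleNr.
  rewrite -[ltnRHS](limg_ker_dim f) -[ltnLHS]add0n ltn_add2r lt0n dimv_eq0.
  apply: contraNneq x0 => W1; rewrite -memv0 -W1 memv_cap xW memv_ker.
  by rewrite add_lfunE opp_lfunE scale_lfunE id_lfunE wx subrr eqxx.
have [mu muE] := choice eig.
(* The operator [e] of minimal rank may fail to be idempotent, even up to a scalar. Some [mu g0] is
   nonzero by [brick_dichotomy], and applying [e], then [g0], then dividing by [mu g0] gives an
   idempotent. *)
have [g0 mug0] : exists g0, mu g0 != 0.
  have [K0 _] := brick_dichotomy act_trivial card_neq0 bS e0.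
  apply: contrapT => mu0; move/eqP: e0; apply; apply/lfunP => s.
  rewrite zero_lfunE.
  apply: K0 => g; rewrite muE; have [->|mug] := eqVneq (mu g) 0.
    by rewrite scale0r.
  by case: mu0; exists g.
have [v vE] := natop_group act g0; have [ve veE] := natop_comp v e.
have [e1 e1E] := natop_scale ve (mu g0)^-1.
have {}e1E s : e1 S s = (mu g0)^-1 *: actG (e S s) g0 by rewrite e1E veE vE.
have e1g s g : e1 S (actG (e1 S s) g) = ((mu g0)^-1 * mu (g0 * g)%g) *: e1 S s.
  rewrite !e1E (lin_Z (actG_linear g)) -actGM // linearZ /= muE.
  by rewrite !(lin_Z (actG_linear g0)) !scalerA; congr (_ *: _); ring.
exists e1, (fun g => (mu g0)^-1 * mu (g0 * g)%g); split=> // [|s].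
  apply: contraNneq e0 => e10; apply/eqP/lfunP => s.
  rewrite zero_lfunE -[LHS](actGK act_trivial g0).
  have -> : actG (e S s) g0 = mu g0 *: e1 S s.
    by rewrite e1E scalerA divff // scale1r.
  by rewrite e10 zero_lfunE scaler0 (linear_fun0 (actG_linear _)).
by have := e1g s 1%g; rewrite actG1 mulg1 mulVf // scale1r.
Qed.

(* Equality of the annihilators in the group algebra; for bricks this means
   that the same irreducible representation of G occurs in both. *)
Definition same_class (S S' : rmod B) : Prop :=
  forall u : natop act, u S = 0 <-> u S' = 0.

Lemma same_class_ext (S S' : rmod B) : brick S -> brick S' ->
  ~ same_class S S' -> ext1_dim S S' = 0%N.
Proof.
move=> bS bS' nSS'; apply: ext1_dim_gequiv0 => // f fG.
apply/eqP; apply: contra_notT nSS' => f0.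
exact: (brick_annihilator act_trivial card_neq0 bS bS' fG f0).
Qed.

(** An [e] that is primitive on [S i0] is primitive on every [S i], so one idempotent compresses the
    whole family compatibly. *)
Lemma same_class_compression (n : nat) (i0 : 'I_n) (S : 'I_n -> rmod B) :
  (forall i, brick (S i)) -> (forall i j, same_class (S i) (S j)) ->
  exists (T : 'I_n -> rmod A) (X : forall i, compression (S i) (T i)),
    forall i j, full_faithful (X i) (X j).
Proof.
move=> bS cS.
have [e [mu pe]] := primitive_exists (bS i0).
have pS i : primitive_on e mu (S i).
  exact: (primitive_on_annihilator (cS i0 i) pe).
have cor i : {T : rmod A & {X : compression (S i) T |
    (forall t, e (S i) (inc X t) = inc X t) /\
    (forall s, inc X (prj X s) = e (S i) s)}}.
  have [_ ee _] := pS i.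
  have [T TP] := cid (corner act_trivial ee).
  by have [X XP] := cid TP; exists T, X.
exists (fun i => projT1 (cor i)), (fun i => sval (projT2 (cor i))) => i j.
have [ei ie] := svalP (projT2 (cor i)); have [ej je] := svalP (projT2 (cor j)).
exact: (corner_full_faithful act_trivial card_neq0 (bS i) (bS j) (pS i) (pS j)).
Qed.

End ClosedField.

(** * Semibricks and Ext-quivers under compression *)

Section Semibrick.

Variables (k : fieldType) (A : fdAlgType k).

(** Vanishing Hom already excludes isomorphisms, as the identity of a brick is nonzero. This form
    without isomorphisms passes directly along compressions. *)
Lemma semibrickP (n : nat) (S : 'I_n -> rmod A) : semibrick S <->
  (forall i, brick (S i)) /\ (forall i j, i != j -> homA (S i) (S j) = 0%VS).
Proof.
split=> [[bS nS hS]|[bS hS]]; first by split=> // i j /nS/hS.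
split=> // i j.
  move=> /hS h0 [f [g [fA _ gf _]]]; have [/eqP[]] := bS i.
  move: fA; rewrite h0 memv0 -gf => /eqP ->; apply/lfunP => s.
  by rewrite comp_lfunE !zero_lfunE linear0.
have [->|/hS //] := eqVneq i j; case.
have id1 : (\1%VF : 'End(S j)) \in homA (S j) (S j).
  by apply/homAP => s a; rewrite !id_lfunE.
by exists \1%VF, \1%VF; split; rewrite // comp_lfun1l.
Qed.

End Semibrick.

Section Transport.

Variables (gT : finGroupType) (k : fieldType) (A : fdAlgType k).
Variables (act : alg_action gT A).
Hypothesis act_trivial : forall (g : gT) (a : A), act g a = a.
Hypothesis card_neq0 : #|gT|%:R != 0 :> k.
Local Notation B := (skew_group_alg act).

Lemma compression_semibrick (n : nat) (S : 'I_n -> rmod B) (T : 'I_n -> rmod A)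
    (X : forall i, compression (S i) (T i)) :
  (forall i j, full_faithful (X i) (X j)) -> semibrick S <-> semibrick T.
Proof.
move=> ffX; rewrite !semibrickP; split=> -[b h]; split=> [i|i j /h].
- exact/(compression_brick act_trivial (ffX i i)).
- by move/(compression_hom0 act_trivial (ffX i j)).
- exact/(compression_brick act_trivial (ffX i i)).
- by move/(compression_hom0 act_trivial (ffX i j)).
Qed.

Lemma compression_quiver (n : nat) (S : 'I_n -> rmod B) (T : 'I_n -> rmod A)
    (X : forall i, compression (S i) (T i)) :
  (forall i j, full_faithful (X i) (X j)) -> ext_quiver S = ext_quiver T.
Proof.
move=> ffX; apply/matrixP => i j; rewrite !mxE.
exact: (compression_ext act_trivial card_neq0 (ffX i j)).
Qed.

(** * Inflation of A-modules to A*G *)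

Section Inflation.

Variable T : rmod A.
Implicit Types (t : T) (b : B).

(** The pullback along the map A*G -> A sending each g to 1, which is multiplicative because G acts
    trivially on A. *)
Definition infl_act t b : T := \sum_g rmod_act t (b g).

Fact infl_act_linearl b : linear (infl_act^~ b).
Proof. by apply: linear_sum_fun => g; apply: rmod_act_linearl. Qed.

Fact infl_act_linearr t : linear (infl_act t).
Proof.
by apply: linear_sum_fun => g c a b; rewrite !ffunE rmod_act_linearr.
Qed.

Fact infl_act_elt t a g : infl_act t (skew_elt act a g) = rmod_act t a.
Proof.
rewrite /infl_act (bigD1 g) //= big1 => [|h hg]; rewrite ffunE.
  by rewrite eqxx addr0.
by rewrite (negPf hg) act_r0.
Qed.

Fact infl_act1 t : infl_act t 1 = t.
Proof. by rewrite infl_act_elt rmod_act1. Qed.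

Fact infl_actM t b b' : infl_act t (b * b') = infl_act (infl_act t b) b'.
Proof.
rewrite /infl_act; transitivity
  (\sum_u \sum_g rmod_act (rmod_act t (b g)) (b' (g^-1 * u)%g)).
  apply: eq_bigr => u _; rewrite ffunE act_rsum; apply: eq_bigr => g _.
  by rewrite act_trivial rmod_actM.
under [RHS]eq_bigr do rewrite act_lsum.
rewrite exchange_big [RHS]exchange_big /=; apply: eq_bigr => g _.
by rewrite (reindex_inj (mulgI g)) /=; apply: eq_bigr => h _; rewrite mulKg.
Qed.

Definition inflation : rmod B :=
  RMod infl_act_linearl infl_act_linearr infl_act1 infl_actM.

Lemma inflation_compression : exists X : compression inflation T,
  (forall t, inc X t = t) /\ (forall s, prj X s = s).
Proof.
pose i : 'Hom(T, inflation) := \1%VF; pose p : 'Hom(inflation, T) := \1%VF.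
have iE t : i t = t by apply: id_lfunE.
have pE t : p t = t by apply: id_lfunE.
have iact t a : i (rmod_act t a) = actA (i t) a.
  by rewrite !iE; apply/esym/infl_act_elt.
have pact s a : p (actA s a) = rmod_act (p s) a.
  by rewrite !pE; apply: infl_act_elt.
have ip t : p (i t) = t by rewrite pE iE.
by exists (@Compression _ _ _ _ inflation T i p iact pact ip).
Qed.

End Inflation.

(** G acts trivially on inflated modules, so every linear map between them is a G-map. *)
Lemma inflation_full_faithful (T T' : rmod A)
    (X : compression (inflation T) T) (X' : compression (inflation T') T') :
  (forall t, inc X t = t) -> (forall s, prj X s = s) ->
  (forall t, inc X' t = t) -> (forall s, prj X' s = s) ->
  full_faithful X X'.
Proof.
move=> iX pX iX' pX'; split=> [f _ f0|h|f _ t].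
- by apply/lfunP => s; have := f0 s; rewrite pX' iX zero_lfunE.
- exists (h : 'Hom(inflation T, inflation T')) => [s g|t].
    have actGE (U : rmod A) (u : inflation U) : actG u g = u.
      by rewrite [LHS](infl_act_elt (u : U)) rmod_act1.
    by rewrite !actGE.
  by rewrite pX' iX.
- by rewrite pX' iX'.
Qed.

End Transport.

(** * Eigenvalues of block diagonal matrices and bounds on spectral radii *)

(** Restrict a row eigenvector to the class of an index where it is nonzero: columns of that class
    have no entries outside it, so the eigenvalue equation survives. *)
Lemma eigenvalue_block (F : fieldType) (n : nat) (Q : 'M[F]_n) (E : rel 'I_n)
    (z : F) :
  reflexive E -> symmetric E -> transitive E ->
  (forall i j, ~~ E i j -> Q i j = 0) -> eigenvalue Q z ->
  exists i0, eigenvalue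
    (mxsub (@enum_val _ (E i0)) (@enum_val _ (E i0)) Q) z.
Proof.
move=> Er Es Et Q0 /eigenvalueP[v vQ /rV0Pn[i0 vi0]]; exists i0.
set f := @enum_val _ (E i0); have f0 : i0 \in E i0 := Er i0.
apply/eigenvalueP; exists (\row_j v 0 (f j)).
  apply/rowP => j; rewrite !mxE; have /rowP/(_ (f j)) := vQ; rewrite !mxE => <-.
  under eq_bigr do rewrite !mxE.
  rewrite -(big_enum_val (fun i => v 0 i * Q i (f j))) /=.
  rewrite [RHS](bigID (mem (E i0))) /= [X in _ + X]big1 ?addr0 // => i iE.
  rewrite Q0 ?mulr0 //; apply: contra iE => ij.
  by have := enum_valP j; move=> i0j; apply: Et i0j _; rewrite Es.
apply/rV0Pn; exists (enum_rank_in f0 i0); rewrite !mxE /f.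
by rewrite enum_rankK_in.
Qed.

Section SpectralRadius.

Variable R : realType.
Local Notation normc := (@ComplexField.Normc.normc R).
Local Notation cmx Q := (map_mx (fun m : nat => m%:R : R[i]) Q).

(** The eigenvalues are among the finitely many roots of the characteristic polynomial. A bound is
    required for the real [sup] to be an upper bound. *)
Lemma eigenvalue_bounded (n : nat) (M : 'M[R[i]]_n) :
  exists b : R, forall z, eigenvalue M z -> normc z <= b.
Proof.
have [rs charE] := closed_field_poly_normal (char_poly M).
exists (\sum_(r <- rs) `|normc r|) => z.
rewrite eigenvalue_root_char charE (monicP (char_poly_monic M)) scale1r.
rewrite root_prod_XsubC => zrs; rewrite (big_rem z) //=.
by rewrite (le_trans (ler_norm _)) // lerDl sumr_ge0.
Qed.

Lemma spectral_radius_ge (n : nat) (Q : 'M[nat]_n) z :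
  eigenvalue (cmx Q) z -> normc z <= spectral_radius R Q.
Proof.
move=> zQ; apply: ub_le_sup; last by exists z.
have [b bP] := eigenvalue_bounded (cmx Q).
by exists b => _ [y yQ <-]; apply: bP.
Qed.

(** The assumption 0 <= x covers an empty set of eigenvalues, whose [sup] is 0 by convention. *)
Lemma spectral_radius_le (n : nat) (Q : 'M[nat]_n) (x : \bar R) :
  (0 <= x)%E -> (forall z, eigenvalue (cmx Q) z -> ((normc z)%:E <= x)%E) ->
  ((spectral_radius R Q)%:E <= x)%E.
Proof.
move=> x0 xP; rewrite /spectral_radius; set E := (X in sup X).
have [->|/set0P E0] := eqVneq E set0; first by rewrite sup0.
case: x x0 xP => [r| |] // _ xP; last by rewrite leey.
rewrite lee_fin; apply: ge_sup => // _ [z zQ <-].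
by rewrite -lee_fin; apply: xP.
Qed.

End SpectralRadius.

(** * Comparison of the two suprema *)

Theorem proposition4p1 (R : realType) (k : closedFieldType) (A : fdAlgType k)
    (gT : finGroupType) (act : alg_action gT A)
    (act_trivial : forall (g : gT) (a : A), act g a = a)
    (char_ndvd : forall p : nat, p \in [pchar k] -> ~~ (p %| #|[set: gT]|)%N) :
  FPdim R (skew_group_alg act) = FPdim R A.
Proof.
have card_neq0 : #|gT|%:R != 0 :> k.
  apply/negP => card0; have [|p pk] := natf0_pchar _ card0.
    by rewrite -cardsT cardG_gt0.
  by have /negP[] := char_ndvd p pk; rewrite cardsT (dvdn_pcharf pk).
(* The empty semibrick contributes the value 0. *)
have FP_ge0 : (0 <= FPdim R A)%E.
  apply: ereal_sup_ubound; exists 0%N.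
  have S : 'I_0 -> rmod A by case.
  exists S; split; last by rewrite spectral_radius_empty.
  by split; case.
apply/eqP; rewrite eq_le; apply/andP; split; apply: ge_ereal_sup.
  move=> _ [n [S [sbS ->]]]; apply: spectral_radius_le => // z zQ.
  have /semibrickP[bS homS] := sbS.
  (* Ext^1 vanishes between different classes, so [z] is already an eigenvalue of the block of one
     class. *)
  pose E i j := `[< same_class (S i) (S j) >].
  have [] := @eigenvalue_block _ n _ E z _ _ _ _ zQ.
  - by move=> i; apply/asboolP.
  - by move=> i j; apply/asboolP/asboolP => ij u; have := ij u => -[].
  - move=> j i l /asboolP ij /asboolP jl; apply/asboolP => u.
    by rewrite ij jl.
  - move=> i j /asboolP nij; rewrite !mxE.
    by rewrite (same_class_ext act_trivial card_neq0 (bS i) (bS j) nij).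
  move=> i0; set f := @enum_val _ (E i0) => zf.
  have fi0 : i0 \in E i0 by apply/asboolP.
  have [||T [X ffX]] := @same_class_compression _ _ _ _ act_trivial card_neq0 _
      (enum_rank_in fi0 i0) (S \o f).
  - by move=> i; apply: bS.
  - have clf i : same_class (S i0) (S (f i)).
      by have := enum_valP i => /asboolP.
    by move=> i j u; rewrite /= -(clf i u) -(clf j u).
  have sbf : semibrick (S \o f).
    apply/semibrickP; split=> [i|i j ij]; first exact: bS.
    by apply: homS; apply: contra_neq ij => /enum_val_inj.
  (* That block is the Ext-quiver of a subfamily, which equals the one of its compression [T], a
     semibrick over A. *)
  apply: (@le_trans _ _ (spectral_radius R (ext_quiver T))%:E).
    rewrite lee_fin; apply: spectral_radius_ge.
    rewrite -(compression_quiver act_trivial card_neq0 ffX).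
    congr (eigenvalue _ z): zf; apply/matrixP => i j; by rewrite !mxE.
  apply: ereal_sup_ubound; exists _, T; split=> //.
  exact/(compression_semibrick act_trivial ffX).
(* Conversely, each semibrick over A inflates to one over A*G with the same Ext-quiver. *)
move=> _ [n [T [sbT ->]]]; apply: ereal_sup_ubound.
have ic i : {X : compression (inflation act_trivial (T i)) (T i) |
    (forall t, inc X t = t) /\ (forall s, prj X s = s)}.
  exact/cid/inflation_compression.
pose X i := sval (ic i).
have ffX i j : full_faithful (X i) (X j).
  have [ii pi] := svalP (ic i); have [ij pj] := svalP (ic j).
  exact: (inflation_full_faithful ii pi ij pj).
exists n, (fun i => inflation act_trivial (T i)); split.
  exact/(compression_semibrick act_trivial ffX).
by rewrite (compression_quiver act_trivial card_neq0 ffX).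
Qed.
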